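(* Let $R$ be a finitely generated, positively graded ring over a field of prime characteristic $p$. Let $d=\dim R$ and let $I$ be a homogeneous ideal of $R$ of height $d-1$. Then the Frobenius powers of $I$ have linear growth of primary decompositions; that is, there exists a number $c$ such that for each $q=p^e$ there is a primary decomposition $I^{[q]}=Q_1\cap Q_2\cap\cdots\cap Q_r$ (with $r$ depending on $q$) such that $(\sqrt{Q_i})^{c[q]}\subseteq Q_i$ for all $i=1,\ldots,r$.
   Context: Rings are commutative and Noetherian. A finitely generated, positively graded ring over a field $k$ is a finitely generated $k$-algebra $R=\bigoplus_{i\ge 0}R_i$ graded by the non-negative integers with $R_0=k$. For a ring of prime characteristic $p$, an ideal $J$ and $q=p^e$ ($e\geq 0$ an integer), the Frobenius power $J^{[q]}$ is the ideal generated by the $q$th powers of generators of $J$. The notation $J^{c[q]}$ means $(J^c)^{[q]}$, the $q$th Frobenius power of the ordinary $c$th power of $J$; $c$ is a positive integer. *)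

(* Defs.v *)
From HB Require Import structures.
From mathcomp Require Import all_boot all_order all_algebra.
From mathcomp Require Import boolp classical_sets.

Set Implicit Arguments.
Unset Strict Implicit.
Unset Printing Implicit Defensive.

Import Order.TTheory GRing.Theory.

Local Open Scope classical_set_scope.
Local Open Scope ring_scope.

Section Ideals.
Variable R : comNzRingType.
Implicit Types (I J P Q S : set R) (c h n q : nat).

(* Unlike idealr_closed, this allows the unit ideal. *)
Definition is_ideal I : Prop :=
  [/\ I 0, (forall x y, I x -> I y -> I (x + y)) &
      (forall a x, I x -> I (a * x))].

Definition ideal_gen S : set R := smallest is_ideal S.

Definition ideal_power J c : set R :=
  ideal_gen [set x | exists2 y : 'I_c -> R,
                       (forall i, J (y i)) & x = \prod_(i < c) y i].

(* J^[q]. J is used as a generating set of itself; when R has characteristic p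
   and q = p ^ e any other generating set of J gives the same ideal, see
   frobenius_power_gen below. *)
Definition frobenius_power J q : set R := ideal_gen [set x ^+ q | x in J].

Definition radical J : set R := [set x | exists n, J (x ^+ n.+1)].

Definition is_prime P : Prop :=
  idealr_closed [in P] /\ prime_idealr_closed [in P].

Definition is_primary Q : Prop :=
  [/\ is_ideal Q, ~ Q 1 &
      forall x y, Q (x * y) -> Q x \/ radical Q y].

Definition primary_decomposition J r (Q : 'I_r -> set R) : Prop :=
  (forall i, is_primary (Q i)) /\ J = \bigcap_i Q i.

(* P 0, ..., P n is a strictly increasing chain of primes of length n; the
   values of P beyond n are irrelevant. *)
Definition prime_chain n (P : nat -> set R) : Prop :=
  (forall i, (i <= n)%N -> is_prime (P i)) /\
  (forall i, (i < n)%N -> P i `<` P i.+1).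

Definition prime_height P h : Prop :=
  (exists C, prime_chain h C /\ C h = P) /\
  (forall n C, prime_chain n C -> C n = P -> (n <= h)%N).

(* The height of I is the least height of a prime containing I. Primes of
   infinite height satisfy prime_height for no h', and the unit ideal has no
   (finite) height. *)
Definition ideal_height I h : Prop :=
  (exists P, [/\ is_prime P, I `<=` P & prime_height P h]) /\
  (forall P h', is_prime P -> I `<=` P -> prime_height P h' -> (h <= h')%N).

Definition linear_growth_primary_decompositions p I : Prop :=
  exists c : nat, (0 < c)%N /\
    forall e : nat, exists (r : nat) (Q : 'I_r -> set R),
      primary_decomposition (frobenius_power I (p ^ e)) Q /\
      forall i, frobenius_power (ideal_power (radical (Q i)) c) (p ^ e) `<=` Q i.

End Ideals.

Definition krull_dim (R : comNzRingType) (d : nat) : Prop :=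
  (exists C : nat -> set R, prime_chain d C) /\
  (forall n (C : nat -> set R), prime_chain n C -> (n <= d)%N).

Section Graded.
Variables (k : fieldType) (R : comAlgType k).

Definition finitely_generated_algebra : Prop :=
  exists s : seq R,
    smallest (fun A : set R => subalg_closed [in A]) [set` s] = setT.

(* R is the internal direct sum of the G i, with G 0 = k. *)
Record positive_grading (G : nat -> set R) : Prop := PositiveGrading {
  grading_submod : forall i, submod_closed [in G i];
  grading_mul : forall i j x y, G i x -> G j y -> G (i + j)%N (x * y);
  grading_span : forall x, exists n (y : nat -> R),
    (forall i, G i (y i)) /\ x = \sum_(i < n) y i;
  grading_free : forall n (y : nat -> R), (forall i, G i (y i)) ->
    \sum_(i < n) y i = 0 -> forall i, (i < n)%N -> y i = 0;
  grading_0 : G 0%N = [set a%:A | a in [set: k]]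
}.

Definition homogeneous_ideal (G : nat -> set R) (I : set R) : Prop :=
  exists2 S : set R, S `<=` \bigcup_i G i & I = ideal_gen S.

End Graded.

Section SanityLemmas.
Variable R : comNzRingType.
Implicit Types (I J S : set R).

Lemma ideal_gen_ideal S : is_ideal (ideal_gen S).
Proof.
split=> [A [[A0 _ _] _] //|x y Sx Sy A [iA SA]|a x Sx A [iA SA]].
- by case: (iA) => _ AD _; apply: AD; [apply: Sx|apply: Sy].
- by case: (iA) => _ _ AM; apply: AM; apply: Sx.
Qed.

Lemma idealr_closed_set I :
  idealr_closed [in I] <-> is_ideal I /\ ~ I 1.
Proof.
have memI x : reflect (I x) (x \in [in I]) by apply: (iffP idP); rewrite in_setE.
split=> [[/memI I0 /memI I1 IL]|[[I0 ID IM] I1]].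
- split=> //; split=> // [x y /memI Ix /memI Iy|a x /memI Ix].
  + by apply/memI; rewrite -[x]mul1r; apply: IL.
  + by apply/memI; rewrite -[a * x]addr0; apply: IL => //; apply/memI.
- split; [exact/memI|exact/memI|].
  by move=> a x y /memI Ix /memI Iy; apply/memI/ID => //; apply: IM.
Qed.

Lemma is_primeP I :
  is_prime I <->
  [/\ is_ideal I, ~ I 1 & forall x y, I (x * y) -> I x \/ I y].
Proof.
have memI x : reflect (I x) (x \in [in I]) by apply: (iffP idP); rewrite in_setE.
rewrite /is_prime idealr_closed_set; split=> [[[iI I1] pI]|[iI I1 pI]].
- by split=> // x y /memI/pI/orP[]/memI ?; [left|right].
- by split=> // x y /memI/pI[]/memI Ix; apply/orP; [left|right].
Qed.

Lemma frobenius_power_gen p e S : p \in [pchar R] ->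
  frobenius_power (ideal_gen S) (p ^ e) = ideal_gen [set x ^+ (p ^ e) | x in S].
Proof.
move=> pR; have pp := pcharf_prime pR.
have [B0 BD BM] := ideal_gen_ideal [set x ^+ (p ^ e) | x in S].
apply/seteqP; split.
- apply: smallest_sub; first exact: ideal_gen_ideal.
  move=> _ [x Sx <-].
  apply: (Sx [set y | ideal_gen [set x ^+ (p ^ e) | x in S] (y ^+ (p ^ e))]).
  split=> [|y Sy]; last by apply: sub_gen_smallest; exists y.
  split=> /= [|y z By Bz|a y By].
  + by rewrite expr0n expn_eq0 eqn0Ngt prime_gt0.
  + rewrite GRing.exprDn_pchar ?pnatX ?pnatE ?pR //; exact: BD.
  + by rewrite exprMn; apply: BM.
- apply: smallest_sub; first exact: ideal_gen_ideal.
  move=> _ [x Sx <-]; apply: sub_gen_smallest; exists x => //.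
  exact: sub_gen_smallest.
Qed.

End SanityLemmas.

(* Main.v *)
Require Import Defs.
From mathcomp Require Import all_boot all_order all_algebra.
From mathcomp Require Import boolp classical_sets.

Set Implicit Arguments.
Unset Strict Implicit.
Unset Printing Implicit Defensive.

Import GRing.Theory.

Local Open Scope classical_set_scope.
Local Open Scope ring_scope.

(** Let [m] be the irrelevant ideal and [q] a power of [p]. As [I] has height
    [dim R - 1], chains of primes above [I] have length at most one, so a
    homogeneous prime above [I] other than [m] is minimal over [I], and there are
    finitely many of these. Noetherian induction gives homogeneous primes [P i]
    above [I], [i < n], with product inside [I]. The decomposition of
    [I^[q]] then consists of the following ideals.

    - For each [P i] other than [m], the elements carried into [I^[q]] by some
      form outside [P i]. This is a primary ideal with radical [P i]. Some form
      [s] outside [P i] carries [(P i)^n] into [I], so [s ^+ q] carries the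
      Frobenius power of [(P i)^n] into [I^[q]] and any [c >= n] works.

    - One ideal primary to [m], namely [I^[q]] plus all elements of degree at
      least [c q]. It contains the Frobenius power of [m^c] for degree reasons.

    What has to be proved is that the intersection is not larger than [I^[q]].
    A form [u] of degree at least [c q] in all the prime components satisfies
    [m^N u <= I^[q]] for some [N], because the colon ideal [I^[q] : u] lies in no
    [P i] but [m] ([power_tail1_sub]); and such [u] must lie in [I^[q]] if
    [c] is large, independently of [q] ([saturation_bound]). So the heart of the
    matter is a bound, linear in [q], for the degrees in which [R / I^[q]] has
    [m]-torsion.

    This bound comes from Koszul homology. Choose by prime avoidance a form [x]
    of positive degree such that [I + x] contains a power of [m], and forms [f i]
    generating [I]. The first Koszul homology of [x] and the [f i] is a
    finitely generated module annihilated by [x] and the [f i], hence vanishes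
    in degrees at least some [t] ([koszul_bounded_exists]). The exact sequence
    relating the sequences with entries [a], [b] and [a b] shows that replacing
    the [f i] by [f i ^+ q] raises [t] by at most [q - 1] times the sum of their
    degrees ([koszul_bounded_powers]). A relation [x u = sum r i (f i)^q] is a
    syzygy of these elements, and if it is trivial then [u] is a combination of
    the [f i ^+ q]. *)

(** * Ascending chains and Hilbert's basis theorem *)

Section Chains.
Variable T : Type.
Implicit Type M : nat -> set T.

Definition ascending M := forall n, M n `<=` M n.+1.

Definition stabilizes M := exists N, forall n, M n `<=` M N.

Lemma ascending_le M m n : ascending M -> (m <= n)%N -> M m `<=` M n.
Proof.
move=> Ma /subnKC <-; elim: (n - m)%N => [|i IH]; first by rewrite addn0.
by rewrite addnS; apply: subset_trans IH (Ma _).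
Qed.

Lemma stabilizes_uniform (M : nat -> nat -> set T) n :
    (forall i, ascending (M i)) -> (forall i, stabilizes (M i)) ->
  exists N, forall i, (i < n)%N -> forall k, M i k `<=` M i N.
Proof.
move=> Ma Ms; elim: n => [|n [N HN]]; first by exists 0%N.
have [N' HN'] := Ms n; exists (maxn N N') => i; rewrite ltnS leq_eqVlt.
case/orP=> [/eqP ->|/HN{}HN] k.
- exact: subset_trans (HN' k) (ascending_le (Ma n) (leq_maxr _ _)).
- exact: subset_trans (HN k) (ascending_le (Ma i) (leq_maxl _ _)).
Qed.

End Chains.

Section HilbertBasis.
Variable R : comNzRingType.
Implicit Types (C M : set R) (y : R).

Definition is_subring C :=
  [/\ C 1, (forall u v, C u -> C v -> C (u - v)) &
      (forall u v, C u -> C v -> C (u * v))].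

Definition ideal_in C M :=
  [/\ M `<=` C, M 0, (forall u v, M u -> M v -> M (u + v)) &
      (forall c u, C c -> M u -> M (c * u))].

Definition acc_in C :=
  forall M : nat -> set R,
    (forall n, ideal_in C (M n)) -> ascending M -> stabilizes M.

Definition polys_below C y n : set R :=
  [set z | exists2 c : nat -> R,
             (forall i, C (c i)) & z = \sum_(i < n) c i * y ^+ i].

Definition adjoin C y : set R := \bigcup_n polys_below C y n.

Section Subring.
Variables (C : set R) (y : R).
Hypothesis ringC : is_subring C.

Lemma subring0 : C 0.
Proof. by case: ringC => C1 CB _; rewrite -(subrr 1); apply: CB. Qed.

Lemma subringD u v : C u -> C v -> C (u + v).
Proof.
case: ringC => C1 CB _ Cu Cv; rewrite -[v]opprK; apply: (CB) => //.
by rewrite -sub0r; apply: CB => //; apply: subring0.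
Qed.

Lemma polys_belowB n u v :
  polys_below C y n u -> polys_below C y n v -> polys_below C y n (u - v).
Proof.
case: ringC => _ CB _ [a Ca ->] [b Cb ->]; exists (fun i => a i - b i).
  by move=> i; apply: CB.
by rewrite -sumrB; apply: eq_bigr => i _; rewrite mulrBl.
Qed.

Lemma polys_belowZ n c u :
  C c -> polys_below C y n u -> polys_below C y n (c * u).
Proof.
case: ringC => _ _ CM Cc [a Ca ->]; exists (fun i => c * a i).
  by move=> i; apply: CM.
by rewrite mulr_sumr; apply: eq_bigr => i _; rewrite mulrA.
Qed.

Lemma polys_belowX n u : polys_below C y n u -> polys_below C y n.+1 (y * u).
Proof.
case=> a Ca ->; exists (fun i => if i is j.+1 then a j else 0).
  by case=> //; exact: subring0.
rewrite big_ord_recl mul0r add0r mulr_sumr; apply: eq_bigr => i _.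
by rewrite exprS mulrCA.
Qed.

Lemma polys_below_ascending : ascending (polys_below C y).
Proof.
move=> n _ [a Ca ->]; exists (fun i => if (i < n)%N then a i else 0).
  by move=> i; case: ifP => // _; apply: subring0.
rewrite big_ord_recr /= ltnn mul0r addr0; apply: eq_bigr => i _.
by rewrite ltn_ord.
Qed.

Lemma polys_belowS n u : polys_below C y n.+1 u ->
  exists2 c, C c & polys_below C y n (u - c * y ^+ n).
Proof.
case=> a Ca ->; exists (a n) => //; exists a => //.
by rewrite big_ord_recr /= addrK.
Qed.

Lemma polys_below0 u : polys_below C y 0 u -> u = 0.
Proof. by case=> a _ ->; rewrite big_ord0. Qed.

Lemma adjoinB u v : adjoin C y u -> adjoin C y v -> adjoin C y (u - v).
Proof.
move=> [m _ Bu] [n _ Bv]; exists (maxn m n) => //; apply: polys_belowB.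
- exact: (ascending_le polys_below_ascending (leq_maxl _ _)) Bu.
- exact: (ascending_le polys_below_ascending (leq_maxr _ _)) Bv.
Qed.

Lemma adjoin_sub : C `<=` adjoin C y.
Proof.
move=> c Cc; exists 1%N => //; exists (fun=> c) => //.
by rewrite big_ord1 mulr1.
Qed.

Lemma adjoin_gen : adjoin C y y.
Proof.
exists 2%N => //; rewrite -[X in polys_below _ _ _ X]mulr1.
apply: polys_belowX; exists (fun=> 1); first by case: ringC.
by rewrite big_ord1 mulr1.
Qed.

Lemma adjoinM u v : adjoin C y u -> adjoin C y v -> adjoin C y (u * v).
Proof.
case=> m _ Bu Av; elim: m u Bu => [|m IH] u.
  move/polys_below0 ->; rewrite mul0r; exact/adjoin_sub/subring0.
case/polys_belowS=> c Cc /IH{}IH.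
have AX : adjoin C y (c * y ^+ m * v).
  case: Av => n _ Bv; exists (n + m)%N => //.
  rewrite -mulrA; apply: polys_belowZ => //.
  elim: m {IH} => [|m IH]; first by rewrite mul1r addn0.
  by rewrite exprS -mulrA addnS; apply: polys_belowX.
have A0 := adjoin_sub subring0.
rewrite -[u](subrK (c * y ^+ m)) mulrDl -[c * y ^+ m * v]opprK.
by apply: adjoinB => //; rewrite -sub0r; apply: adjoinB.
Qed.

Lemma adjoin_subring : is_subring (adjoin C y).
Proof.
split; [apply: adjoin_sub; by case: ringC|exact: adjoinB|exact: adjoinM].
Qed.

Definition lead_coefs M n : set R :=
  [set c | C c /\ exists2 b, M b & polys_below C y n (b - c * y ^+ n)].

Lemma lead_coefs_ideal M n :
  ideal_in (adjoin C y) M -> ideal_in C (lead_coefs M n).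
Proof.
case=> _ M0 MD MM; split=> [c []//||u v|c u Cc].
- split; first exact: subring0.
  exists 0 => //; exists (fun=> 0) => [_|]; first exact: subring0.
  by rewrite mul0r subr0 big1 // => i _; rewrite mul0r.
- case=> Cu [b Mb Bb] [Cv [b' Mb' Bb']]; split; first exact: subringD.
  exists (b + b'); first exact: MD.
  rewrite mulrDl opprD addrACA -[X in _ + X]opprK; apply: polys_belowB => //.
  by rewrite -mulN1r; apply: polys_belowZ => //; rewrite -sub0r;
     case: ringC => C1 CB _; apply: CB => //; apply: subring0.
- case=> Cu [b Mb Bb]; split; first by case: ringC => _ _; apply.
  exists (c * b); first by apply: MM => //; apply: adjoin_sub.
  by rewrite -mulrA -mulrBr; apply: polys_belowZ.
Qed.

Lemma lead_coefs_ascending M :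
  ideal_in (adjoin C y) M -> ascending (lead_coefs M).
Proof.
case=> _ _ _ MM n c [Cc [b Mb Bb]]; split=> //; exists (y * b).
  by apply: MM => //; apply: adjoin_gen.
by rewrite exprS mulrCA -mulrBr; apply: polys_belowX.
Qed.

Lemma lead_coefs_mono M M' n :
  M `<=` M' -> lead_coefs M n `<=` lead_coefs M' n.
Proof. by move=> sMM' c [Cc [b /sMM' Mb Bb]]; split=> //; exists b. Qed.

(** From an element of [M] subtract one of [M'] with the same leading
    coefficient, and conclude by induction on the degree. *)
Lemma sub_of_lead_coefs M M' :
    ideal_in (adjoin C y) M -> ideal_in (adjoin C y) M' -> M' `<=` M ->
    (forall n, lead_coefs M n `<=` lead_coefs M' n) ->
  M `<=` M'.
Proof.
move=> [MA _ MD MM] [MA' M0' MD' MM'] sM'M sL b Mb; have [n _ Bb] := MA _ Mb.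
elim: n b Mb Bb => [|n IH] b Mb; first by move/polys_below0 ->.
case/polys_belowS=> c Cc Bb.
have [_ [b' Mb' Bb']] : lead_coefs M' n c by apply: sL; split=> //; exists b.
have AN : adjoin C y (-1).
  have := adjoin_subring; case=> A1 AB _; rewrite -sub0r; apply: AB => //.
  exact/adjoin_sub/subring0.
rewrite -[b](subrK b'); apply: MD' => //; apply: IH.
  by apply: MD => //; rewrite -mulN1r; apply: MM => //; apply: sM'M.
by have := polys_belowB Bb Bb'; rewrite opprB addrA subrK.
Qed.

(** Hilbert's basis theorem. An ideal of [C[y]] is determined, inside a larger
    one, by its ideals of leading coefficients.  For a chain [M] of ideals these
    form a family increasing in the degree [n] and in the index [k]; the
    diagonal stabilizes at some [N], which settles all [n >= N], and the finitely
    many degrees below [N] stabilize one by one. *)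
Lemma hilbert_basis : acc_in C -> acc_in (adjoin C y).
Proof.
move=> accC M idM Ma.
pose L n k := lead_coefs (M k) n.
have Lk n : ascending (L n) by move=> k; apply: lead_coefs_mono.
have Ln k : ascending (L ^~ k) by apply: lead_coefs_ascending.
have [|n c Lc|N HN] := accC (fun n => L n n).
- by move=> n; apply: lead_coefs_ideal.
- exact/Lk/Ln.
have [n|K HK] := stabilizes_uniform N Lk.
  by apply: accC => // k; apply: lead_coefs_ideal.
exists (maxn N K) => k; have [kK|/ltnW Kk] := leqP k (maxn N K).
  exact: ascending_le kK.
apply: sub_of_lead_coefs => //; first exact: ascending_le.
move=> n c Lc; have [nN|Nn] := ltnP n N.
  exact: (ascending_le (Lk n) (leq_maxr _ _)) (HK n nN k c Lc).
have: L (maxn n k) (maxn n k) c.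
  apply: (ascending_le (Ln _) (leq_maxl n k)).
  exact: (ascending_le (Lk n) (leq_maxr n k)) Lc.
move/HN => LN.
apply: (ascending_le (Ln _) Nn).
exact: (ascending_le (Lk N) (leq_maxl _ _)) LN.
Qed.

End Subring.

Definition noetherian := acc_in [set: R].

End HilbertBasis.

(** The generators are adjoined one at a time to the field of scalars, whose only
    ideals are [0] and itself. *)
Lemma finitely_generated_noetherian (k : fieldType) (R : comAlgType k) :
  finitely_generated_algebra R -> noetherian R.
Proof.
case=> s genR.
pose scal : set R := [set a%:A | a in [set: k]].
pose alg := foldr (fun y C => adjoin C y) scal s.
have ring_scal : is_subring scal.
  split; first by exists 1; rewrite ?scale1r.
    by move=> _ _ [a _ <-] [b _ <-]; exists (a - b); rewrite ?scalerBl.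
  move=> _ _ [a _ <-] [b _ <-]; exists (a * b) => //.
  by rewrite -scalerA -[in RHS]scalerAl mul1r.
have acc_scal : acc_in scal.
  move=> M idM Ma.
  have [[n [u [Mu u0]]]|M0] := pselect (exists n u, M n u /\ u != 0).
    exists n => m v Mv; have [MC _ _ MM] := idM n.
    have [a _ ua] := MC _ Mu; have [b _ <-] : scal v by case: (idM m) => /(_ v Mv).
    have a0 : a != 0 by apply: contraNneq u0 => a0; rewrite -ua a0 scale0r.
    suff ->: b%:A = (b / a)%:A * u by apply: MM => //; exists (b / a).
    by rewrite -ua -scalerAl mul1r scalerA divfK.
  exists 0%N => n u Mu; have [->|u0] := eqVneq u 0; first by case: (idM 0%N).
  by case: M0; exists n, u.
have algP : [/\ is_subring alg, acc_in alg, scal `<=` alg & [set` s] `<=` alg].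
  rewrite /alg; elim: (s) => [|y t [rt acct sct st]] /=.
    by split=> // x; rewrite /= in_nil.
  have sub := @adjoin_sub _ (foldr (fun y C => adjoin C y) scal t) y.
  split; [exact: adjoin_subring|exact: hilbert_basis|exact: subset_trans sub|].
  move=> x /=; rewrite inE => /orP[/eqP ->|xt]; first exact: adjoin_gen.
  exact/sub/st.
case: algP => ring_alg acc_alg sc_alg s_alg.
suff algT : alg = [set: R] by rewrite /noetherian -algT.
apply/seteqP; split=> //; rewrite -genR; apply: smallest_sub => //.
case: (ring_alg) => A1 _ AM.
split=> [|a u v|u v]; rewrite ?in_setE // => Au Av; last exact: AM.
apply: subringD => //; rewrite -[u]mul1r scalerAl.
by apply: AM => //; apply: sc_alg; exists a.
Qed.

Section Noetherian.
Variable R : comNzRingType.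
Hypothesis noethR : noetherian R.
Implicit Types (J S : set R).

Lemma ideal_chain_stabilizes (M : nat -> set R) :
  (forall n, is_ideal (M n)) -> ascending M -> stabilizes M.
Proof.
by move=> idM; apply: noethR => n; case: (idM n) => M0 MD MM; split=> // *; apply: MM.
Qed.

(** A failure at [J] propagates to a strictly larger ideal, and dependent choice
    makes an infinite chain of the failures. *)
Lemma noetherian_ind (H : set R -> Prop) :
    (forall J, is_ideal J ->
       (forall J', is_ideal J' -> J `<` J' -> H J') -> H J) ->
  forall J, is_ideal J -> H J.
Proof.
move=> HI J idJ; apply: contrapT => nHJ.
pose bad := {J : set R | is_ideal J /\ ~ H J}.
have step (B : bad) : {B' : bad | sval B `<` sval B'}.
  apply: cid; case: B => A [idA nHA] /=; apply: contrapT => noB; apply: nHA.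
  apply: HI => // A' idA' ltA; apply: contrapT => nHA'; apply: noB.
  by exists (exist _ A' (conj idA' nHA')).
pose M n := sval (iter n (fun B => sval (step B)) (exist _ J (conj idJ nHJ))).
have Mlt n : M n `<` M n.+1 by rewrite /M iterS; case: (step _).
have [n||N HN] := @ideal_chain_stabilizes M; last by case: (Mlt N) => _; apply; apply: HN.
- by rewrite /M; case: (iter _ _ _) => ? [].
- by move=> n; case: (Mlt n).
Qed.

(** Noetherian induction on the ideal generated by a finite part of [S]: if that
    ideal misses an element of [S], enlarge the part by it. *)
Lemma finite_generators S : exists l : seq R,
  [set` l] `<=` S /\ S `<=` ideal_gen [set` l].
Proof.
suff: forall J, is_ideal J -> (exists2 l : seq R, [set` l] `<=` S & J = ideal_gen [set` l]) ->
    exists l : seq R, [set` l] `<=` S /\ S `<=` ideal_gen [set` l].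
  move/(_ _ (ideal_gen_ideal [set` [::]])); apply.
  by exists [::] => // x; rewrite /= in_nil.
apply: noetherian_ind => J idJ IH [l lS JE].
have [SJ|/existsNP[x /not_implyP[Sx nJx]]] := pselect (S `<=` J).
  by exists l; rewrite -JE.
have lJ : J `<=` ideal_gen [set` x :: l].
  rewrite JE; apply: sub_smallest2r; first exact: ideal_gen_ideal.
  by move=> z /=; rewrite inE => ->; rewrite orbT.
apply: (IH (ideal_gen [set` x :: l])); first exact: ideal_gen_ideal.
  split=> // H; apply: nJx; apply: H.
  by apply: sub_gen_smallest; rewrite /= mem_head.
exists (x :: l) => // z /=; rewrite inE => /orP[/eqP ->//|]; exact: lS.
Qed.

Section FreeModule.
Variable I : finType.

Definition is_submodule (M : set (I -> R)) :=
  [/\ M (fun=> 0), (forall z w, M z -> M w -> M (fun i => z i + w i)) &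
      (forall a z, M z -> M (fun i => a * z i))].

(** Induction on a set of indices supporting all the submodules, splitting off
    the ideals of values at one index. *)
Lemma submodule_chain_stabilizes (M : nat -> set (I -> R)) :
  (forall n, is_submodule (M n)) -> ascending M -> stabilizes M.
Proof.
suff main : forall (s : seq I) (M : nat -> set (I -> R)),
    (forall n, is_submodule (M n)) ->
    (forall n z, M n z -> forall i, i \notin s -> z i = 0) ->
    ascending M -> stabilizes M.
  by move=> mM; apply: (main (enum I)) => // n z _ i; rewrite mem_enum.
elim=> [|i0 s IH] {}M mM sM Ma.
  exists 0%N => n z Mz; suff ->: z = (fun=> 0) by case: (mM 0%N).
  by apply/funext => i; apply: sM Mz _ _.
pose L n : set R := [set z i0 | z in M n].
pose M' n : set (I -> R) := [set z | M n z /\ z i0 = 0].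
have [n||NL HL] := @ideal_chain_stabilizes L.
- case: (mM n) => M0 MD MM; split=> [|_ _ [z Mz <-] [w Mw <-]|a _ [z Mz <-]].
  + by exists (fun=> 0).
  + by exists (fun i => z i + w i) => //; apply: MD.
  + by exists (fun i => a * z i) => //; apply: MM.
- by move=> n _ [z Mz <-]; exists z => //; apply: Ma.
have [n|n z [Mz z0] i ins||N' H'] := IH M'.
- case: (mM n) => M0 MD MM; split=> [//|z w [Mz z0] [Mw w0]|a z [Mz z0]].
  + by split; [apply: MD|rewrite z0 w0 addr0].
  + by split; [apply: MM|rewrite z0 mulr0].
- have [->//|ii0] := eqVneq i i0.
  by apply: (sM _ _ Mz); rewrite inE negb_or ii0.
- by move=> n z [Mz z0]; split=> //; apply: Ma.
exists (maxn NL N') => n z Mz.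
have [w MLw wz] : L NL (z i0) by apply: (HL n); exists z.
have Mw := ascending_le Ma (leq_maxl NL N') MLw.
pose n' := maxn n NL.
have [Mv _] : M' N' (fun i => z i + (-1) * w i).
  apply: (H' n'); split; last by rewrite wz mulN1r subrr.
  case: (mM n') => _ MD MM; apply: MD.
    exact: (ascending_le Ma (leq_maxl _ _)) Mz.
  by apply: MM; apply: (ascending_le Ma (leq_maxr _ _)) MLw.
case: (mM (maxn NL N')) => _ MD _.
have := MD _ _ (ascending_le Ma (leq_maxr NL N') Mv) Mw.
by under eq_fun do rewrite mulN1r subrK.
Qed.

End FreeModule.

End Noetherian.

(** * Ideals and primes *)

Section IdealLemmas.
Variable R : comNzRingType.
Implicit Types (I J P S : set R).

Definition colon J a : set R := [set x | J (x * a)].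

Lemma colon_ideal J a : is_ideal J -> is_ideal (colon J a).
Proof.
case=> J0 JD JM; split=> [|x y Jx Jy|b x Jx]; rewrite /colon /=.
- by rewrite mul0r.
- by rewrite mulrDl; apply: JD.
- by rewrite -mulrA; apply: JM.
Qed.

Lemma ideal_mulr J a x : is_ideal J -> J x -> J (x * a).
Proof. by case=> _ _ JM Jx; rewrite mulrC; apply: JM. Qed.

Lemma ideal_oppr J x : is_ideal J -> J x -> J (- x).
Proof. by case=> _ _ JM Jx; rewrite -mulN1r; apply: JM. Qed.

Lemma ideal_subr J x y : is_ideal J -> J x -> J y -> J (x - y).
Proof. by move=> idJ Jx Jy; case: (idJ) => _ JD _; apply: JD => //; apply: ideal_oppr. Qed.

Lemma ideal_sumr J (K : Type) (r : seq K) (Q : pred K) (F : K -> R) :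
  is_ideal J -> (forall i, Q i -> J (F i)) -> J (\sum_(i <- r | Q i) F i).
Proof. by case=> J0 JD _; apply: big_ind. Qed.

Lemma ideal_unit J : is_ideal J -> J 1 -> forall x, J x.
Proof. by case=> _ _ JM J1 x; rewrite -[x]mulr1; apply: JM. Qed.

Lemma prime_ideal P : is_prime P -> is_ideal P.
Proof. by case/is_primeP. Qed.

Lemma prime_expr P x n : is_prime P -> P (x ^+ n) -> P x.
Proof.
case/is_primeP=> idP P1 PM; elim: n => [/P1//|n IH].
by rewrite exprS => /PM[].
Qed.

Lemma prime_prod P n (x : 'I_n -> R) :
  is_prime P -> P (\prod_(i < n) x i) -> exists i, P (x i).
Proof.
case/is_primeP=> idP P1 PM; elim: n x => [|n IH] x; first by rewrite big_ord0.
rewrite big_ord_recl => /PM[Px|/IH[i Px]]; first by exists ord0.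
by exists (lift ord0 i).
Qed.

Lemma ideal_gen_family (I : finType) (g : I -> R) x :
  ideal_gen [set g i | i in [set: I]] x -> exists a : I -> R, x = \sum_i a i * g i.
Proof.
move=> gx; apply: (gx [set x | exists a : I -> R, x = \sum_i a i * g i]); split.
- split=> [|_ _ [a ->] [b ->]|c _ [a ->]].
  + by exists (fun=> 0); rewrite big1 // => i _; rewrite mul0r.
  + exists (fun i => a i + b i); rewrite -big_split /=.
    by apply: eq_bigr => i _; rewrite mulrDl.
  + exists (fun i => c * a i); rewrite mulr_sumr.
    by apply: eq_bigr => i _; rewrite mulrA.
- move=> _ [i _ <-]; exists (fun j => (j == i)%:R).
  rewrite (bigD1 i) //= eqxx mul1r big1 ?addr0 // => j /negPf ->.
  by rewrite mul0r.
Qed.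

Definition add_gen J a : set R := [set x | exists2 y, J y & exists b, x = y + b * a].

Lemma add_gen_ideal J a : is_ideal J -> is_ideal (add_gen J a).
Proof.
case=> J0 JD JM; split=> [|_ _ [y Jy [b ->]] [z Jz [c ->]]|c _ [y Jy [b ->]]].
- by exists 0 => //; exists 0; rewrite mul0r addr0.
- by exists (y + z); [exact: JD|exists (b + c); rewrite mulrDl addrACA].
- by exists (c * y); [exact: JM|exists (c * b); rewrite mulrDr mulrA].
Qed.

Lemma add_gen_sub J a : J `<=` add_gen J a.
Proof. by move=> x Jx; exists x => //; exists 0; rewrite mul0r addr0. Qed.

Lemma add_gen_mem J a : is_ideal J -> add_gen J a a.
Proof. by case=> J0 _ _; exists 0 => //; exists 1; rewrite mul1r add0r. Qed.

End IdealLemmas.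

(** * Homogeneous components *)

Section Grading.
Variables (k : fieldType) (R : comAlgType k) (G : nat -> set R).
Hypothesis gradG : positive_grading G.
Implicit Types (x y z : R) (J : set R).

Lemma piece0 i : G i 0.
Proof. by have [+ _] := grading_submod gradG i; rewrite in_setE. Qed.

Lemma pieceZD i (a : k) x y : G i x -> G i y -> G i (a *: x + y).
Proof.
by have [_ H] := grading_submod gradG i; move=> *; rewrite -in_setE H ?in_setE.
Qed.

Lemma pieceD i x y : G i x -> G i y -> G i (x + y).
Proof. by move=> Gx; rewrite -[x]scale1r; apply: pieceZD. Qed.

Lemma pieceB i x y : G i x -> G i y -> G i (x - y).
Proof. by rewrite addrC -scaleN1r => *; apply: pieceZD. Qed.

Lemma piece_scalar (a : k) : G 0 a%:A.
Proof. by rewrite (grading_0 gradG); exists a. Qed.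

Lemma piece1 : G 0 1.
Proof. by rewrite -[X in G 0 X]scale1r; exact: piece_scalar. Qed.

Lemma pieceX i x n : G i x -> G (n * i)%N (x ^+ n).
Proof.
move=> Gx; elim: n => [|n IH]; first exact: piece1.
by rewrite exprS mulSn; apply: grading_mul.
Qed.

Definition is_decomposition x (p : {poly R}) :=
  (forall i, G i p`_i) /\ p.[1] = x.

Lemma decomposition_exists x : exists p, is_decomposition x p.
Proof.
have [n [y [Gy ->]]] := grading_span gradG x.
exists (\poly_(i < n) y i); split=> [i|].
  by rewrite coef_poly; case: ifP => // _; apply: piece0.
by rewrite horner_poly; apply: eq_bigr => i _; rewrite expr1n mulr1.
Qed.

Lemma decomposition_unique x p q :
  is_decomposition x p -> is_decomposition x q -> p = q.
Proof.
move=> [Gp px] [Gq qx]; apply/subr0_eq/polyP => i; rewrite coef0.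
have [ip|ip] := ltnP i (size (p - q)); last by rewrite nth_default.
apply: (grading_free gradG (n := size (p - q)) (y := nth 0 (p - q))) => //.
  by move=> j; rewrite coefB; apply: pieceB.
have: (p - q).[1] = 0 by rewrite !hornerE px qx subrr.
rewrite horner_coef => pq; rewrite -[RHS]pq.
by apply: eq_bigr => j _; rewrite expr1n mulr1.
Qed.

(** The homogeneous components of [x] are kept as the coefficients of a
    polynomial: [x |-> decomp x] is a ring morphism, a section of evaluation at
    [1], so that components of products are computed by [coefM]. *)
Definition decomp x : {poly R} := sval (cid (decomposition_exists x)).

Definition component i x : R := (decomp x)`_i.

Lemma decompP x : is_decomposition x (decomp x).
Proof. by rewrite /decomp; case: cid. Qed.

Lemma decompE x p : is_decomposition x p -> decomp x = p.
Proof. exact/decomposition_unique/decompP. Qed.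

Lemma comp_piece i x : G i (component i x).
Proof. by case: (decompP x). Qed.

Lemma compE x n : (size (decomp x) <= n)%N -> x = \sum_(i < n) component i x.
Proof.
move=> xn; have [_ {1}<-] := decompP x; rewrite (horner_coef_wide _ xn).
by apply: eq_bigr => i _; rewrite expr1n mulr1.
Qed.

Lemma decompD x y : decomp (x + y) = decomp x + decomp y.
Proof.
have [[Gx xE] [Gy yE]] := (decompP x, decompP y).
apply: decompE; split=> [i|]; last by rewrite hornerD xE yE.
by rewrite coefD; apply: pieceD.
Qed.

Lemma decompB x y : decomp (x - y) = decomp x - decomp y.
Proof.
have [[Gx xE] [Gy yE]] := (decompP x, decompP y).
apply: decompE; split=> [i|]; last by rewrite hornerD hornerN xE yE.
by rewrite coefB; apply: pieceB.
Qed.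

Lemma decompM x y : decomp (x * y) = decomp x * decomp y.
Proof.
have [[Gx xE] [Gy yE]] := (decompP x, decompP y).
apply: decompE; split=> [i|]; last by rewrite hornerM xE yE.
rewrite coefM; apply: big_ind; [exact: piece0|exact: pieceD|] => j _.
rewrite -[X in G X _](subnKC (leq_ord j)).
exact: grading_mul (comp_piece _ _) (comp_piece _ _).
Qed.

Lemma decomp_homog i x : G i x -> decomp x = x *: 'X^i.
Proof.
move=> Gx; apply: decompE; split=> [j|]; last by rewrite !hornerE expr1n mulr1.
rewrite coefZ coefXn; case: eqP => [->|_]; first by rewrite mulr1.
by rewrite mulr0; apply: piece0.
Qed.

Lemma compD i x y : component i (x + y) = component i x + component i y.
Proof. by rewrite /component decompD coefD. Qed.

Lemma compB i x y : component i (x - y) = component i x - component i y.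
Proof. by rewrite /component decompB coefB. Qed.

Lemma comp0 i : component i 0 = 0.
Proof. by have := compB i 0 0; rewrite !subrr. Qed.

Lemma compN i x : component i (- x) = - component i x.
Proof. by rewrite -sub0r compB comp0 sub0r. Qed.

Lemma comp_sum i (K : Type) (r : seq K) (Q : pred K) (F : K -> R) :
  component i (\sum_(j <- r | Q j) F j) = \sum_(j <- r | Q j) component i (F j).
Proof. exact: (big_morph _ (compD i) (comp0 i)). Qed.

Lemma compM i x y : component i (x * y) = \sum_(j < i.+1) component j x * component (i - j) y.
Proof. by rewrite /component decompM coefM. Qed.

Lemma comp_homog i j x : G i x -> component j x = if j == i then x else 0.
Proof.
move=> /decomp_homog dx; rewrite /component dx coefZ coefXn.
by case: eqP; rewrite ?mulr1 ?mulr0.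
Qed.

Lemma compMhomog i j a x : G i a ->
  component j (a * x) = if (j < i)%N then 0 else a * component (j - i) x.
Proof.
move=> /decomp_homog da; rewrite /component decompM da -scalerAl coefZ coefXnM.
by case: ifP; rewrite ?mulr0.
Qed.

Lemma comp_ext x y : (forall i, component i x = component i y) -> x = y.
Proof.
move=> xy; have [_ <-] := decompP x; have [_ <-] := decompP y.
by congr (_.[1]); apply/polyP.
Qed.

(** The ideal spanned by the pieces of degree at least [n]; the irrelevant
    maximal ideal of the graded ring is [tail 1]. *)
Definition tail n : set R := [set x | forall i, (i < n)%N -> component i x = 0].

Lemma tailM m n x y : tail m x -> tail n y -> tail (m + n) (x * y).
Proof.
move=> mx ny i imn; rewrite compM big1 // => j _.
have [jm|mj] := ltnP j m; first by rewrite mx // mul0r.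
by rewrite ny ?mulr0 // ltn_subLR ?leq_ord // (leq_trans imn) // leq_add2r.
Qed.

Lemma tail_ideal n : is_ideal (tail n).
Proof.
split=> [i _|x y nx ny i ni|a x nx]; first exact: comp0.
  by rewrite compD nx // ny // addr0.
by rewrite -[n]add0n; apply: tailM.
Qed.

Lemma tail_le m n : (m <= n)%N -> tail n `<=` tail m.
Proof. by move=> mn x nx i im; apply: nx; apply: leq_trans mn. Qed.

Lemma compM_tail m n x y : tail m x -> tail n y ->
  component (m + n) (x * y) = component m x * component n y.
Proof.
move=> mx ny; rewrite compM.
have lt_m : (m < (m + n).+1)%N by rewrite ltnS leq_addr.
rewrite (bigD1 (Ordinal lt_m)) //= addKn big1 ?addr0 // => j.
rewrite -val_eqE /= neq_ltn => /orP[jm|mj]; first by rewrite mx ?mul0r.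
by rewrite ny ?mulr0 // ltn_subLR ?leq_ord // ltn_add2r.
Qed.

Lemma tail_piece i n x : G i x -> (n <= i)%N -> tail n x.
Proof.
move=> Gx ni j jn; rewrite (comp_homog _ Gx); case: eqP => // ji.
by rewrite ji ltnNge ni in jn.
Qed.

Lemma tailX n m x : tail n x -> tail (n * m) (x ^+ m).
Proof.
move=> nx; elim: m => [|m IH]; first by rewrite muln0.
by rewrite mulnS exprS; apply: tailM.
Qed.

Lemma compX_tail n m x : tail n x -> component (n * m) (x ^+ m) = component n x ^+ m.
Proof.
move=> nx; elim: m => [|m IH]; first by rewrite muln0 (comp_homog _ piece1).
by rewrite mulnS !exprS compM_tail ?IH //; apply: tailX.
Qed.

Lemma comp_tail n i x : tail n x -> tail n (component i x).
Proof.
move=> nx; have [/nx ->|ni] := ltnP i n; first by case: (tail_ideal n).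
exact: tail_piece (comp_piece _ _) ni.
Qed.

Lemma tail1_prime : is_prime (tail 1).
Proof.
apply/is_primeP; split=> [|/(_ 0%N isT)|x y /(_ 0%N isT)]; first exact: tail_ideal.
  by rewrite (comp_homog _ piece1) eqxx => /eqP; rewrite oner_eq0.
rewrite compM big_ord1 subn0.
have := comp_piece 0 x; rewrite {1}(grading_0 gradG) => -[a _ ax].
have [a0|a0] := eqVneq a 0.
  by move=> _; left=> -[] // _; rewrite /= -ax a0 scale0r.
rewrite -ax -scalerAl mul1r => /eqP; rewrite scaler_eq0 (negPf a0) => /eqP y0.
by right=> -[].
Qed.

Definition trunc n x : R := x - \sum_(i < n) component i x.

Lemma comp_trunc n i x : component i (trunc n x) = if (i < n)%N then 0 else component i x.
Proof.
rewrite compB comp_sum; case: ltnP => [lt_in|ni].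
  rewrite (bigD1 (Ordinal lt_in)) //= (comp_homog _ (comp_piece i x)) eqxx.
  rewrite big1 ?addr0 ?subrr // => j; rewrite -val_eqE /= eq_sym => ji.
  by rewrite (comp_homog _ (comp_piece j x)) (negPf ji).
rewrite big1 ?subr0 // => j _; rewrite (comp_homog _ (comp_piece j x)).
by case: eqP => // ij; have := ltn_ord j; rewrite ltnNge -ij ni.
Qed.

Lemma trunc_tail n x : tail n (trunc n x).
Proof. by move=> i ni; rewrite comp_trunc ni. Qed.

Lemma trunc_id n x : tail n x -> trunc n x = x.
Proof. by move=> nx; rewrite /trunc big1 ?subr0 // => i _; apply: nx. Qed.

Lemma truncD n x y : trunc n (x + y) = trunc n x + trunc n y.
Proof. by apply: comp_ext => i; rewrite !(compD, comp_trunc); case: ifP; rewrite ?addr0. Qed.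

Lemma truncN n x : trunc n (- x) = - trunc n x.
Proof. by apply: comp_ext => i; rewrite !(compN, comp_trunc); case: ifP; rewrite ?oppr0. Qed.

Lemma trunc0 n : trunc n 0 = 0.
Proof. by apply: comp_ext => i; rewrite comp_trunc comp0 if_same. Qed.

Lemma trunc_sum n (K : Type) (r : seq K) (Q : pred K) (F : K -> R) :
  trunc n (\sum_(j <- r | Q j) F j) = \sum_(j <- r | Q j) trunc n (F j).
Proof. exact: (big_morph _ (truncD n) (trunc0 n)). Qed.

Lemma truncMhomog n i a x : G i a -> trunc n (a * x) = a * trunc (n - i) x.
Proof.
move=> Ga; apply: comp_ext => j; rewrite comp_trunc !(compMhomog _ _ Ga) comp_trunc.
have [ji|ij] := ltnP j i; first by rewrite if_same.
have [jn|nj] := ltnP j n; first by rewrite ltn_sub2r ?mulr0 // (leq_ltn_trans ij).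
by rewrite ltnNge leq_sub2r.
Qed.

(** Discarding the low-degree parts of the coefficients changes the combination
    in low degrees only, where it vanishes. *)
Lemma tail_combination (I : finType) (g : I -> R) (d : I -> nat) (a : I -> R) n :
    (forall i, G (d i) (g i)) -> tail n (\sum_i a i * g i) ->
  exists2 b, (forall i, tail (n - d i) (b i)) &
             \sum_i a i * g i = \sum_i b i * g i.
Proof.
move=> Gg nx; exists (fun i => trunc (n - d i) (a i)) => [i|].
  exact: trunc_tail.
rewrite -(trunc_id nx) trunc_sum; apply: eq_bigr => i _.
by rewrite mulrC (truncMhomog _ _ (Gg i)) mulrC.
Qed.

Definition comp_closed J := forall x i, J x -> J (component i x).

Lemma homogeneous_comp_closed J : homogeneous_ideal G J -> comp_closed J.
Proof.
case=> S SG -> x i Jx; have [J0 JD JM] := ideal_gen_ideal S.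
move: i; apply: (Jx [set x | forall i, ideal_gen S (component i x)]); split.
  split=> [i|y z Jy Jz i|a y Jy i] /=; first by rewrite comp0.
    by rewrite compD; apply: JD.
  rewrite compM; apply: ideal_sumr; first exact: ideal_gen_ideal.
  by move=> j _; apply: JM.
move=> y Sy i; have [j _ Gy] := SG _ Sy; rewrite (comp_homog _ Gy).
by case: eqP => // _; apply: sub_gen_smallest.
Qed.

Lemma comp_closed_ext J x : is_ideal J -> (forall i, J (component i x)) -> J x.
Proof. by move=> idJ Jx; rewrite (compE (leqnn (size (decomp x)))); apply: ideal_sumr. Qed.

Lemma comp_closed_colon J i a : comp_closed J -> G i a -> comp_closed (colon J a).
Proof.
move=> cJ Ga x j; rewrite /colon /= => /cJ - /(_ (i + j)%N).
by rewrite mulrC (compMhomog _ _ Ga) ltnNge leq_addr addKn mulrC.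
Qed.

Lemma comp_closed_add_gen J i a :
  comp_closed J -> G i a -> comp_closed (add_gen J a).
Proof.
move=> cJ Ga _ j [y Jy [b ->]]; exists (component j y); first exact: cJ.
rewrite compD [b * a]mulrC (compMhomog _ _ Ga).
case: ltnP => _; first by exists 0; rewrite mul0r.
by exists (component (j - i) b); rewrite mulrC.
Qed.

(** A proper homogeneous ideal lies in the irrelevant ideal: a nonzero
    component of degree 0 is a unit. *)
Lemma comp_closed_sub_tail1 J :
  is_ideal J -> comp_closed J -> ~ J 1 -> J `<=` tail 1.
Proof.
move=> idJ cJ J1 x Jx [] // _; have [J0 _ JM] := idJ.
have := comp_piece 0 x; rewrite {1}(grading_0 gradG) => -[a _ ax].
have [a0|a0] := eqVneq a 0; first by rewrite -ax a0 scale0r.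
case: J1; have := JM (a^-1)%:A _ (cJ x 0%N Jx).
by rewrite -ax -scalerAl mul1r scalerA mulVf // scale1r.
Qed.

Lemma lowest_component_notin J z : is_ideal J -> ~ J z ->
  exists i, ~ J (component i z) /\ forall j, (j < i)%N -> J (component j z).
Proof.
move=> idJ nJz.
have ex : exists i, `[< ~ J (component i z) >].
  apply: contrapT => H; apply: nJz; apply: comp_closed_ext => // i.
  by apply: contrapT => Hi; apply: H; exists i; apply/asboolP.
case/ex_minnP: ex => i /asboolP Hi min; exists i; split=> // j ji.
by apply: contrapT => /asboolP /min; rewrite leqNgt ji.
Qed.

(** The lowest components outside [J] of two elements outside [J] multiply into
    a component of the product, up to [J]; so primality may be tested on
    homogeneous elements. *)
Lemma homogeneous_primeP J :
    is_ideal J -> comp_closed J -> ~ J 1 ->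
    (forall i j a b, G i a -> G j b -> J (a * b) -> J a \/ J b) ->
  is_prime J.
Proof.
move=> idJ cJ J1 JM; apply/is_primeP; split=> // x y Jxy.
apply: contrapT => /not_orP[nJx nJy].
have low := lowest_component_notin idJ.
have [[i [nJi lowi]] [j [nJj lowj]]] := (low x nJx, low y nJy).
have := cJ _ (i + j)%N Jxy; rewrite compM.
have lt_i : (i < (i + j).+1)%N by rewrite ltnS leq_addr.
rewrite (bigD1 (Ordinal lt_i)) //= addKn => Js.
suff /(ideal_subr idJ Js) : J (\sum_(l < (i + j).+1 | l != Ordinal lt_i)
                             component l x * component (i + j - l) y).
  by rewrite addrK => /(JM _ _ _ _ (comp_piece _ _) (comp_piece _ _))[].
apply: ideal_sumr => // l; rewrite -val_eqE /= neq_ltn => /orP[li|il].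
  by apply: ideal_mulr => //; apply: lowi.
case: (idJ) => _ _ JmM; apply: JmM; apply: lowj.
by rewrite ltn_subLR ?leq_ord // ltn_add2r.
Qed.

End Grading.

(** * Homogeneous primes above an ideal of coheight one *)

Section ShortChains.
Variable R : comNzRingType.
Implicit Types (I J P Q : set R).

Definition prod_sub n (P : 'I_n -> set R) J :=
  forall y : 'I_n -> R, (forall i, P i (y i)) -> J (\prod_(i < n) y i).

Lemma prime_above_prod n (P : 'I_n -> set R) J Q :
  is_prime Q -> J `<=` Q -> prod_sub P J -> exists i, P i `<=` Q.
Proof.
move=> pQ JQ PJ; apply: contrapT => noi.
have /choice[y yP] : forall i, exists y, P i y /\ ~ Q y.
  move=> i; apply: contrapT => H; apply: noi; exists i => y Py.
  by apply: contrapT => nQy; apply: H; exists y.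
have [i Qyi] : exists i, Q (y i).
  by apply: prime_prod => //; apply/JQ/PJ => i; case: (yP i).
by case: (yP i).
Qed.

(** The inequality [dim (R / I) <= 1], in the only form needed. *)
Definition short_chains I := forall P0 P1 P2,
  is_prime P0 -> is_prime P1 -> is_prime P2 ->
  I `<=` P0 -> P0 `<` P1 -> P1 `<` P2 -> False.

Lemma prime_height_exists d P :
  krull_dim R d -> is_prime P -> exists h, prime_height P h.
Proof.
case=> _ bd pP.
pose ends n := `[< exists C, prime_chain n C /\ C n = P >].
have ex0 : exists n, ends n.
  by exists 0%N; apply/asboolP; exists (fun=> P); split=> //; split.
have bnd n : ends n -> (n <= d)%N by move/asboolP=> [C [/bd]].
have [h /asboolP hP hmax] := ex_maxnP ex0 bnd.
by exists h; split=> // n C chC Cn; apply: hmax; apply/asboolP; exists C.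
Qed.

(** A chain of length two above [I] would prolong a longest chain of primes
    ending at its first term, of length at least [h], beyond the dimension. *)
Lemma height_short_chains d h I :
  krull_dim R d -> ideal_height I h -> d = h.+1 -> short_chains I.
Proof.
move=> dimR [_ minI] dh P0 P1 P2 p0 p1 p2 I0 lt01 lt12.
have [h0 hgt0] := prime_height_exists dimR p0.
have hh0 := minI _ _ p0 I0 hgt0.
case: hgt0 => [[C [[primC ltC] C0]] _].
pose D i := if (i <= h0)%N then C i else if i == h0.+1 then P1 else P2.
suff chD : prime_chain h0.+2 D.
  by case: dimR => _ /(_ _ _ chD); rewrite dh ltnS ltnNge hh0.
split=> i.
  move=> _; rewrite /D; case: leqP => [/primC//|_]; by case: ifP.
move=> ih; rewrite /D; case: (ltngtP i h0) => [lt_ih|lt_hi|->].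
- exact: ltC.
- have -> : i = h0.+1 by apply/eqP; rewrite eqn_leq lt_hi -ltnS ih.
  by rewrite eqxx gtn_eqF.
- by rewrite eqxx C0.
Qed.

End ShortChains.

Section HomogeneousPrimes.
Variables (k : fieldType) (R : comAlgType k) (G : nat -> set R).
Hypothesis gradG : positive_grading G.
Hypothesis noethR : noetherian R.
Implicit Types (I J P Q : set R).

Local Notation component := (component gradG).
Local Notation tail := (tail gradG).
Local Notation comp_closed := (comp_closed gradG).

(** Noetherian induction: if [J] is not prime, some homogeneous [a], [b] outside
    [J] have their product in [J], and then [(J + a) (J + b)] lies in [J]. *)
Lemma homogeneous_prime_product J : is_ideal J -> comp_closed J ->
  exists n (P : 'I_n -> set R),
    (forall i, [/\ is_prime (P i), comp_closed (P i) & J `<=` P i]) /\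
    prod_sub P J.
Proof.
move: J; apply: (noetherian_ind noethR) => J idJ IH cJ.
have [J1|nJ1] := pselect (J 1).
  by exists 0%N, (fun=> J); split=> [[]|y _] //; rewrite big_ord0.
have [pJ|npJ] := pselect (is_prime J).
  by exists 1%N, (fun=> J); split=> [_|y Jy]; [split|rewrite big_ord1].
have [i [j [a [b [Ga Gb Jab nJa nJb]]]]] : exists i j a b,
    [/\ G i a, G j b, J (a * b), ~ J a & ~ J b].
  apply: contrapT => H; apply: npJ.
  apply: (homogeneous_primeP (gradG := gradG)) => // i j a b Ga Gb Jab.
  by apply: contrapT => /not_orP[nJa nJb]; apply: H; exists i, j, a, b.
have bigger c : ~ J c -> J `<` add_gen J c.
  move=> nJc; split; first exact: add_gen_sub.
  by move/(_ c (add_gen_mem _ idJ)).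
have [n1 [P1 [P1p P1J]]] := IH _ (add_gen_ideal a idJ) (bigger a nJa)
  (comp_closed_add_gen cJ Ga).
have [n2 [P2 [P2p P2J]]] := IH _ (add_gen_ideal b idJ) (bigger b nJb)
  (comp_closed_add_gen cJ Gb).
exists (n1 + n2)%N, (fun l => match split l with inl l1 => P1 l1 | inr l2 => P2 l2 end).
split=> [l|y Py].
  case: (split l) => l'.
  - by case: (P1p l') => ? ? s; split=> //; apply: subset_trans s; apply: add_gen_sub.
  - by case: (P2p l') => ? ? s; split=> //; apply: subset_trans s; apply: add_gen_sub.
rewrite big_split_ord /=.
have [l|u Ju [c ->]] := P1J (fun l => y (lshift n2 l)).
  by have := Py (lshift n2 l); rewrite (unsplitK (inl l)).
have [l|v Jv [e ->]] := P2J (fun l => y (rshift n1 l)).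
  by have := Py (rshift n1 l); rewrite (unsplitK (inr l)).
case: (idJ) => _ JD JM; rewrite mulrDl; apply: (JD); first exact: ideal_mulr.
rewrite mulrDr; apply: (JD); first exact: JM.
by rewrite mulrACA; apply: JM.
Qed.

Lemma homogeneous_prime_sub_tail1 Q : is_prime Q -> comp_closed Q -> Q `<=` tail 1.
Proof. by move=> pQ cQ; case/is_primeP: (pQ) => ? ? _; apply: comp_closed_sub_tail1. Qed.

(** Generators of the irrelevant ideal have positive degrees bounded by some
    [w], so an element of degree at least [N * w] is a combination of [N]-fold
    products of elements of positive degree. *)
Lemma tail_sub_power : exists w : nat, forall N J,
  is_ideal J -> prod_sub (fun _ : 'I_N => tail 1) J -> tail (N * w) `<=` J.
Proof.
pose S : set R := [set x | exists2 i, (0 < i)%N & G i x].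
have [l [lS Sl]] := finite_generators noethR S.
pose g (i : 'I_(size l)) := tnth (in_tuple l) i.
have /choice[e eP] : forall i, exists e, (0 < e)%N /\ G e (g i).
  by move=> i; have [e e0 Ge] := lS _ (mem_tnth i (in_tuple l)); exists e.
have gen1 u : tail 1 u -> exists a, u = \sum_i a i * g i.
  move=> u1; apply: ideal_gen_family.
  have lg : [set` l] `<=` [set g i | i in [set: _]].
    by move=> x /= xl; have /tnthP[i ->] : x \in in_tuple l by []; exists i.
  apply: (sub_smallest2r _ lg); first exact: ideal_gen_ideal.
  apply: (comp_closed_ext (gradG := gradG)) => [|[|i]]; first exact: ideal_gen_ideal.
    by rewrite u1 //; case: (ideal_gen_ideal [set` l]).
  by apply: Sl; exists i.+1 => //; apply: comp_piece.
(* The successor keeps the bound positive when there are no generators. *)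
exists (\sum_i e i).+1 => N; elim: N => [|N IH] J idJ Jprod.
  by move=> x _; apply: ideal_unit => //; have := Jprod (fun=> 1); rewrite big_ord0; apply=> -[].
move=> u uN; have [a ua] : exists a, u = \sum_i a i * g i.
  by apply: gen1; apply: tail_le uN; rewrite muln_gt0.
rewrite ua in uN *.
have [b bt ->] := tail_combination (fun i => (eP i).2) uN.
apply: ideal_sumr => // i _.
apply: (IH (colon J (g i))); first exact: colon_ideal.
  move=> y y1; rewrite /colon /= mulrC.
  pose f j := if unlift ord0 j is Some j' then y j' else g i.
  have <- : \prod_(j < N.+1) f j = g i * \prod_(j < N) y j.
    rewrite big_ord_recl /f unlift_none; congr (_ * _).
    by apply: eq_bigr => j _; rewrite liftK.
  apply: Jprod => j; rewrite /f; case: unliftP => [j' _|_]; first exact: y1.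
  by case: (eP i) => e0 /(tail_piece gradG); apply.
apply: tail_le (bt i); rewrite mulSn addSn leq_subRL.
  by rewrite leqW // leq_add2r (bigD1 i) //= leq_addr.
by rewrite leqW // (leq_trans _ (leq_addr _ _)) // (bigD1 i) //= leq_addr.
Qed.

(** Homogeneous prime avoidance: given a form [x] outside some of the primes
    but in one more prime [P], multiply forms of the other primes outside [P] to
    get [z] outside [P] and in the others, and pass to [x ^+ e + z ^+ d], the
    exponents being chosen to make this homogeneous. *)
Lemma homogeneous_prime_avoidance n (P : 'I_n -> set R) :
    (forall i, is_prime (P i) /\ comp_closed (P i)) ->
    (forall i j, P i <> tail 1 -> P j <> tail 1 -> P i `<=` P j -> P i = P j) ->
  exists d x, [/\ (0 < d)%N, G d x & forall i, P i <> tail 1 -> ~ P i x].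
Proof.
move=> primeP incP.
suff main m : exists d x, [/\ (0 < d)%N, G d x &
    forall i : 'I_n, (i < m)%N -> P i <> tail 1 -> ~ P i x].
  by have [d [x [d0 Gx xP]]] := main n; exists d, x; split=> // i; apply: xP.
elim: m => [|m [d [x [d0 Gx xP]]]].
  by exists 1%N, 0; split=> //; apply: (piece0 gradG).
have [mn|nm] := ltnP m n; last first.
  by exists d, x; split=> // i _; apply: xP; apply: leq_trans nm.
pose i0 := Ordinal mn.
have old : P i0 = tail 1 \/ ~ P i0 x -> exists d x, [/\ (0 < d)%N, G d x &
    forall i : 'I_n, (i < m.+1)%N -> P i <> tail 1 -> ~ P i x].
  move=> H; exists d, x; split=> // i; rewrite ltnS leq_eqVlt => /orP[/eqP im|]; last exact: xP.
  have -> : i = i0 by apply: val_inj.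
  by case: H => [Pt /(_ Pt)|].
have [Pm|nPm] := pselect (P i0 = tail 1); first by apply: old; left.
have [P0x|nP0x] := pselect (P i0 x); last by apply: old; right.
have [pr0 c0] := primeP i0; have id0 := prime_ideal pr0.
have [y [y1 nP0y]] : exists y, tail 1 y /\ ~ P i0 y.
  apply: contrapT => H; apply: nPm; apply/seteqP; split.
    exact: homogeneous_prime_sub_tail1.
  by move=> y y1; apply: contrapT => nPy; apply: H; exists y.
have [ey [nPyc _]] := lowest_component_notin gradG id0 nP0y.
have ey0 : (0 < ey)%N.
  by case: ey nPyc => // -[]; rewrite y1 //; case: id0.
have /choice[w wP] : forall j : 'I_n, exists w : nat * R,
    [/\ G w.1 w.2, ~ P i0 w.2 & (j < m)%N -> P j <> tail 1 -> P j w.2].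
  move=> j; have [[jm Pj]|nj] := pselect ((j < m)%N /\ P j <> tail 1); last first.
    exists (0%N, 1); split=> [||jm Pj]; first exact: (piece1 gradG).
      by case/is_primeP: pr0.
    by case: nj.
  have [v [Pv nP0v]] : exists v, P j v /\ ~ P i0 v.
    apply: contrapT => H; apply: (xP j jm Pj); rewrite (incP j i0) // => v Pv.
    by apply: contrapT => nPv; apply: H; exists v.
  have [e [nPe _]] := lowest_component_notin gradG id0 nP0v.
  exists (e, component e v); split=> //=; first exact: comp_piece.
  by move=> _ _; case: (primeP j) => _; apply.
pose e := (\sum_j (w j).1 + ey)%N.
pose z := (\prod_j (w j).2) * component ey y.
have Gz : G e z.
  apply: (grading_mul gradG); last exact: comp_piece.
  apply: (big_rec2 (fun e z => G e z)); first exact: (piece1 gradG).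
  by move=> j e' z' _; apply: (grading_mul gradG); case: (wP j).
have nP0z : ~ P i0 z.
  case/is_primeP: (pr0) => _ _ PM /PM[]// /(prime_prod pr0)[j].
  by case: (wP j).
have Pz (j : 'I_n) : (j < m)%N -> P j <> tail 1 -> P j z.
  move=> jm Pj; case: (primeP j) => /prime_ideal idj _.
  rewrite /z (bigD1 j) //= -mulrA; apply: ideal_mulr => //.
  by case: (wP j) => _ _; apply.
have e0 : (0 < e)%N by rewrite addn_gt0 ey0 orbT.
exists (e * d)%N, (x ^+ e + z ^+ d); split; first by rewrite muln_gt0 e0.
  by apply: (pieceD gradG); [|rewrite mulnC]; apply: pieceX.
have powin Q v q : is_ideal Q -> (0 < q)%N -> Q v -> Q (v ^+ q).
  by move=> idQ; case: q => // q _ Qv; rewrite exprS; apply: ideal_mulr.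
move=> j; rewrite ltnS leq_eqVlt => /orP[/eqP jm _|jm Pj Pj'].
  have -> : j = i0 by apply: val_inj.
  move/(ideal_subr id0)/(_ (powin _ _ _ id0 e0 P0x)).
  by rewrite addrAC subrr add0r => /(prime_expr pr0).
have [prj _] := primeP j; have idj := prime_ideal prj.
have := ideal_subr idj Pj' (powin _ _ _ idj d0 (Pz j jm Pj)).
by rewrite addrK => /(prime_expr prj); apply: xP.
Qed.

Section OneDimensional.
Variables (I : set R) (n : nat) (P : 'I_n -> set R).
Hypothesis shortI : short_chains I.
Hypothesis primeP : forall i, [/\ is_prime (P i), comp_closed (P i) & I `<=` P i].
Hypothesis prodP : prod_sub P I.

(** A proper inclusion would be prolonged by the irrelevant ideal to a chain of
    length two above [I]. *)
Lemma homogeneous_prime_maximal Q Q' :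
    is_prime Q -> I `<=` Q -> is_prime Q' -> comp_closed Q' ->
    Q `<=` Q' -> Q' <> tail 1 -> Q = Q'.
Proof.
move=> pQ IQ pQ' cQ' QQ' Q't; apply: contrapT => nQQ'.
apply: (shortI pQ pQ' (tail1_prime gradG) IQ); split=> //.
- by move=> Q'Q; apply: nQQ'; apply/seteqP.
- exact: homogeneous_prime_sub_tail1.
- by move=> tQ'; apply: Q't; apply/seteqP; split=> //; apply: homogeneous_prime_sub_tail1.
Qed.

(** A homogeneous prime above [J] contains some [P i], but not one distinct from
    the irrelevant ideal, as there the inclusion would be an equality. So the
    irrelevant ideal is the only homogeneous prime above [J], and a product of
    copies of it lies in [J]. *)
Lemma power_tail1_sub J :
    is_ideal J -> comp_closed J ->
    (forall Q, is_prime Q -> J `<=` Q -> I `<=` Q) ->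
    (forall i, P i <> tail 1 -> ~ (J `<=` P i)) ->
  exists N, prod_sub (fun _ : 'I_N => tail 1) J.
Proof.
move=> idJ cJ JI JP.
have [N [P' [P'p P'J]]] := homogeneous_prime_product idJ cJ.
exists N => y y1; apply: P'J => i; have [pP' cP' JP'] := P'p i.
suff ->: P' i = tail 1 by [].
have IP' := JI _ pP' JP'; apply: contrapT => nP't.
have [j jP'] := prime_above_prod pP' IP' prodP.
have [pPj _ IPj] := primeP j.
have PjE := homogeneous_prime_maximal pPj IPj pP' cP' jP' nP't.
by apply: (JP j); rewrite PjE.
Qed.

(** By prime avoidance there is a form [x] of positive degree outside all the
    [P i] but the irrelevant ideal; then [R / (I + x)] has finite length. *)
Lemma homogeneous_parameter : is_ideal I -> comp_closed I ->
  exists d x N, [/\ (0 < d)%N, G d x,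
    forall i, P i <> tail 1 -> ~ P i x &
    tail N `<=` add_gen I x].
Proof.
move=> idI cI.
have [i|i j Pi Pj Pij|d [x [d0 Gx xP]]] := @homogeneous_prime_avoidance n P.
- by case: (primeP i).
- have [[pPi _ IPi] [pPj cPj _]] := (primeP i, primeP j).
  exact: homogeneous_prime_maximal.
have [||Q _ JQ|i Pi|N NJ] := @power_tail1_sub (add_gen I x).
- exact: add_gen_ideal.
- exact: comp_closed_add_gen Gx.
- exact: subset_trans (add_gen_sub _) JQ.
- by move/(_ x (add_gen_mem _ idI)); apply: xP.
have [w wP] := tail_sub_power.
by exists d, x, (N * w)%N; split=> //; apply: wP => //; apply: add_gen_ideal.
Qed.

End OneDimensional.

End HomogeneousPrimes.

(** * Koszul homology of powers of forms *)

Section Koszul.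
Variables (k : fieldType) (R : comAlgType k) (G : nat -> set R).
Hypothesis gradG : positive_grading G.
Variable I : finType.
Implicit Types (g z : I -> R) (d : I -> nat).

Local Notation component := (component gradG).
Local Notation tail := (tail gradG).
Local Notation trunc := (trunc gradG).

Definition alternating (C : I -> I -> R) :=
  (forall i, C i i = 0) /\ (forall i j, C j i = - C i j).

Definition trivial_syzygy g z :=
  exists2 C, alternating C & forall i, z i = \sum_j C i j * g j.

(** The vanishing in degrees at least [t] of the first Koszul homology of [g],
    whose entries have degrees [d]. Filtering by [tail] makes the truncated
    differences of degrees harmless, because [tail 0] is the whole ring. *)
Definition koszul_bounded t g d := forall n z, (t <= n)%N ->
  (forall i, tail (n - d i) (z i)) -> \sum_i z i * g i = 0 ->
  exists2 C, alternating C & (forall i j, tail (n - d i - d j) (C i j)) /\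
    forall i, z i = \sum_j C i j * g j.

Lemma trivial_syzygy_submodule g : is_submodule (trivial_syzygy g).
Proof.
split=> [|z w [C [C0 CN] zE] [D [D0 DN] wE]|a z [C [C0 CN] zE]].
- exists (fun _ _ => 0); first by split=> // *; rewrite oppr0.
  by move=> i; rewrite big1 // => j _; rewrite mul0r.
- exists (fun i j => C i j + D i j).
    split=> [i|i j]; first by rewrite C0 D0 addr0.
    by rewrite CN DN opprD.
  move=> i; rewrite zE wE -big_split /=.
  by apply: eq_bigr => j _; rewrite mulrDl.
- exists (fun i j => a * C i j).
    split=> [i|i j]; first by rewrite C0 mulr0.
    by rewrite CN mulrN.
  by move=> i; rewrite zE mulr_sumr; apply: eq_bigr => j _; rewrite mulrA.
Qed.

(** The usual homotopy: for [a = g j] the matrix below is the exterior product of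
    [z] and the [j]-th basis vector, whose Koszul boundary is [a * z] because
    that of [z] is zero. *)
Lemma ideal_annihilates_koszul g z a :
    (exists b, a = \sum_i b i * g i) -> \sum_i z i * g i = 0 ->
  trivial_syzygy g (fun i => a * z i).
Proof.
move=> [b ->] zg; exists (fun i j => z i * b j - z j * b i).
  by split=> [i|i j]; rewrite ?subrr ?opprB.
move=> i; under [RHS]eq_bigr do rewrite mulrBl -mulrA mulrAC.
by rewrite sumrB -mulr_sumr -mulr_suml zg mul0r subr0 mulrC.
Qed.

(** The matrix is truncated entry by entry; it stays alternating because the
    degree of truncation is symmetric in the two indices. *)
Lemma trivial_syzygy_tail g d n z :
    (forall i, G (d i) (g i)) -> (forall i, tail (n - d i) (z i)) ->
    trivial_syzygy g z ->
  exists2 C, alternating C & (forall i j, tail (n - d i - d j) (C i j)) /\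
    forall i, z i = \sum_j C i j * g j.
Proof.
move=> Gg zn [C [C0 CN] zE].
exists (fun i j => trunc (n - d i - d j) (C i j)).
  split=> [i|i j]; first by rewrite C0 trunc0.
  by rewrite CN truncN subnAC.
split=> [i j|i]; first exact: trunc_tail.
rewrite -[LHS](trunc_id (zn i)) zE trunc_sum; apply: eq_bigr => j _.
by rewrite mulrC (truncMhomog _ _ _ (Gg j)) mulrC.
Qed.

(** The piece of degree [D] of the family [z], where the [i]-th basis vector is
    given the degree [d i]. *)
Definition vpiece d D z : I -> R :=
  fun i => if (d i <= D)%N then component (D - d i) (z i) else 0.

Lemma vpiece_syzygy g d D z :
    (forall i, G (d i) (g i)) -> \sum_i z i * g i = 0 ->
  \sum_i vpiece d D z i * g i = 0.
Proof.
move=> Gg zg; transitivity (component D (\sum_i z i * g i)).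
  rewrite comp_sum; apply: eq_bigr => i _.
  rewrite [z i * g i]mulrC (compMhomog _ _ _ (Gg i)) /vpiece.
  by case: leqP => _; rewrite ?mul0r // mulrC.
by rewrite zg comp0.
Qed.

Lemma vpiece_sum d z : exists n, forall i, z i = \sum_(D < n) vpiece d D z i.
Proof.
exists (\sum_i (size (decomp gradG (z i)) + d i))%N => i.
set n := (\sum_i _)%N.
have ni : (size (decomp gradG (z i)) + d i <= n)%N by rewrite /n (bigD1 i) //= leq_addr.
rewrite -(big_mkord xpredT (fun D => vpiece d D z i)) (big_cat_nat (n := d i)) //=; last first.
  exact: leq_trans (leq_addl _ _) ni.
rewrite big_nat big1 ?add0r; last first.
  by move=> D /andP[_ Dd]; rewrite /vpiece leqNgt Dd.
rewrite -{1}[d i]add0n big_addn big_mkord [LHS](@compE _ _ _ gradG _ (n - d i)).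
  by apply: eq_bigr => D _; rewrite /vpiece leq_addl addnK.
by rewrite leq_subRL ?(leq_trans (leq_addl _ _) ni) // addnC.
Qed.

(** The module of syzygies of [g] is generated in bounded degrees, by
    noetherianity, and a generator multiplied by a ring element of large degree
    becomes trivial, as the ideal of [g] contains all such elements. *)
Lemma koszul_bounded_exists g d N : noetherian R ->
    (forall i, G (d i) (g i)) ->
    (forall a, tail N a -> exists b, a = \sum_i b i * g i) ->
  exists t, koszul_bounded t g d.
Proof.
move=> noethR Gg gN.
(* The homogeneous syzygies of degree [D]. *)
pose form D z := (forall i, if (d i <= D)%N then G (D - d i)%N (z i) else z i = 0)
                 /\ \sum_i z i * g i = 0.
pose B n := smallest (@is_submodule R I) [set z | exists2 D, (D <= n)%N & form D z].
have subB n : is_submodule (B n).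
  split=> [M [[M0 _ _] _] //|z w Bz Bw M MM|a z Bz M MM].
  - by case: (MM) => -[_ MD _] _; apply: MD; [apply: Bz|apply: Bw].
  - by case: (MM) => -[_ _ Mm] _; apply: Mm; apply: Bz.
have [|t Bt] := submodule_chain_stabilizes noethR subB.
  move=> n; apply: sub_smallest2r; first exact: (subB n.+1).
  move=> z [D Dn fz].
  by exists D => //; apply: leqW.
exists (t + N)%N => n z tn zn zg.
apply: trivial_syzygy_tail => //.
have vform D : form D (vpiece d D z).
  split=> [i|]; last exact: vpiece_syzygy.
  by rewrite /vpiece; case: leqP => // _; apply: comp_piece.
have Btz : B t z.
  have [m zE] := vpiece_sum d z.
  have -> : z = (fun i => \sum_(D < m) vpiece d D z i) by apply/funext.
  elim: (m) => [|j IH].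
    rewrite (_ : (fun i => _) = fun=> 0); first by case: (subB t).
    by apply/funext => i; rewrite big_ord0.
  rewrite (_ : (fun i => _) = fun i => \sum_(D < j) vpiece d D z i + vpiece d j z i).
    case: (subB t) => _ BD _; apply: BD => //.
    by apply: (Bt j); apply: sub_gen_smallest; exists j.
  by apply/funext => i; rewrite big_ord_recr.
pose tr z i := trunc (n - d i) (z i).
have [T0 TD TM] := trivial_syzygy_submodule g.
have -> : z = tr z by apply/funext => i; rewrite /tr trunc_id.
(* The factor [a] makes the property of [z] stable under multiplication by
   scalars, so that it can be checked on the generators of [B t]. *)
suff main : forall a, trivial_syzygy g (tr (fun i => a * z i)).
  by have := main 1; rewrite (_ : (fun i => 1 * z i) = z) //; apply/funext => i; rewrite mul1r.
apply: (Btz [set y | forall a, trivial_syzygy g (tr (fun i => a * y i))]); split.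
  split=> [a|y w Ty Tw a|c y Ty a].
  - rewrite (_ : tr _ = fun=> 0) //.
    by apply/funext => i; rewrite /tr mulr0 trunc0.
  - rewrite (_ : tr _ = fun i => tr (fun i => a * y i) i + tr (fun i => a * w i) i).
      exact: TD.
    by apply/funext => i; rewrite /tr mulrDr truncD.
  - rewrite (_ : tr _ = tr (fun i => a * c * y i)) //.
    by apply/funext => i; rewrite /tr mulrA.
move=> y [D Dt [yD yg]] a.
rewrite (_ : tr _ = fun i => trunc (n - D) a * y i).
  apply: ideal_annihilates_koszul => //; apply: gN.
  apply: tail_le (trunc_tail _ _); rewrite leq_subRL.
    by apply: leq_trans tn; rewrite leq_add2r.
  by apply: leq_trans tn; apply: leq_trans (leq_addr _ _).
apply/funext => i; rewrite /tr; have := yD i.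
case: leqP => [dD Gy|_ ->]; last by rewrite !mulr0 trunc0.
rewrite mulrC (truncMhomog _ _ _ Gy) mulrC subnBA // subnK //.
exact: leq_trans dD (leq_trans Dt (leq_trans (leq_addr N t) tn)).
Qed.

Definition upd (T : Type) (g : I -> T) i0 a : I -> T :=
  fun i => if i == i0 then a else g i.

Lemma upd_eq T (g : I -> T) i0 a : upd g i0 a i0 = a.
Proof. by rewrite /upd eqxx. Qed.

Lemma upd_neq T (g : I -> T) i0 a i : i != i0 -> upd g i0 a i = g i.
Proof. by rewrite /upd => /negPf ->. Qed.

(** The exact sequence H_1(a, h) -> H_1(a b, h) -> H_1(b, h) of Koszul
    homology, whose first map raises degrees by the degree of [b]. For a syzygy
    [z] of the family with [a * b], multiplying the entry [i0] by [a] gives a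
    syzygy of the family with [b]; the column [i0] of a matrix [C] trivializing
    it, completed by [z i0], is a syzygy of the family with [a], trivialized by
    some [D]; and [C + b D] trivializes [z] once its row and column [i0] are
    replaced by those of [D]. *)
Lemma koszul_bounded_mul t i0 g d a da b db :
    (forall i, i != i0 -> G (d i) (g i)) -> G da a -> G db b ->
    koszul_bounded t (upd g i0 a) (upd d i0 da) ->
    koszul_bounded t (upd g i0 b) (upd d i0 db) ->
  koszul_bounded (t + db) (upd g i0 (a * b)) (upd d i0 (da + db)%N).
Proof.
move=> Gg Ga Gb Ka Kb n z tn zn zg.
have tn' : (t <= n)%N by apply: leq_trans tn; apply: leq_addr.
pose z' := upd z i0 (a * z i0).
have z'n i : tail (n - upd d i0 db i) (z' i).
  rewrite /z'; case: (eqVneq i i0) => [->|ii0].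
    rewrite !upd_eq; have := zn i0; rewrite upd_eq => zn0.
    apply: tail_le (tailM (tail_piece gradG Ga (leqnn _)) zn0).
    by rewrite -leq_subLR [(da + db)%N]addnC subnDA.
  by have := zn i; rewrite !upd_neq.
have z'g : \sum_i z' i * upd g i0 b i = 0.
  rewrite -[RHS]zg; apply: eq_bigr => i _; rewrite /z'.
  case: (eqVneq i i0) => [->|ii0]; last by rewrite !upd_neq.
  by rewrite !upd_eq mulrA [z i0 * a]mulrC.
have [C [C0 CN] [Cn CE]] := Kb n z' tn' z'n z'g.
pose y := upd (C ^~ i0) i0 (z i0).
have yn i : tail (n - db - upd d i0 da i) (y i).
  rewrite /y; case: (eqVneq i i0) => [->|ii0].
    by have := zn i0; rewrite !upd_eq addnC subnDA.
  by have := Cn i i0; rewrite upd_eq !upd_neq // subnAC.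
have Ci0 : a * z i0 = \sum_(j | j != i0) C i0 j * g j.
  have := CE i0; rewrite /z' upd_eq => ->.
  rewrite (bigD1 i0) //= C0 mul0r add0r; apply: eq_bigr => j jj0.
  by rewrite upd_neq.
have yg : \sum_i y i * upd g i0 a i = 0.
  rewrite (bigD1 i0) //= /y !upd_eq mulrC Ci0 -big_split /= big1 // => j jj0.
  by rewrite !upd_neq // [C j i0]CN mulNr subrr.
have [|D [D0 DN] [_ DE]] := Ka (n - db)%N y _ yn yg.
  by rewrite leq_subRL 1?addnC // (leq_trans _ tn) // leq_addl.
apply: trivial_syzygy_tail => // [i|].
  case: (eqVneq i i0) => [->|ii0]; last by rewrite !upd_neq //; apply: Gg.
  by rewrite !upd_eq; apply: grading_mul.
exists (fun i j => if (i == i0) || (j == i0) then D i j else C i j + b * D i j).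
  split=> [i|i j]; first by rewrite orbb D0 C0 mulr0 addr0 if_same.
  by rewrite orbC; case: ifP => _; rewrite DN // CN mulrN opprD.
move=> i; case: (eqVneq i i0) => [->|ii0] /=.
  have := DE i0; rewrite /y upd_eq => ->.
  rewrite [LHS](bigD1 i0) // [RHS](bigD1 i0) //= D0 !mul0r; congr (_ + _).
  by apply: eq_bigr => j jj0; rewrite !upd_neq.
have := CE i; rewrite /z' upd_neq // => ->.
have := DE i; rewrite /y upd_neq // => yi.
rewrite [LHS](bigD1 i0) //= upd_eq yi mulr_suml [X in X + _](bigD1 i0) //=.
rewrite [RHS](bigD1 i0) //= eqxx !upd_eq -mulrA -addrA; congr (_ + _).
rewrite -big_split /=; apply: eq_bigr => j jj0.
by rewrite (negPf jj0) !upd_neq // mulrDl addrC; congr (_ + _); rewrite mulrAC [b * _]mulrC.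
Qed.

(** Raising an entry from [a.-1]-st to [a]-th power costs its degree, by
    comparison with the families having that entry with exponents [a.-1] and
    [1]; so the bound grows linearly in the exponents. *)
Lemma koszul_bounded_powers t g d : (forall i, G (d i) (g i)) ->
    koszul_bounded t g d ->
  forall a : I -> nat, (forall i, (0 < a i)%N) ->
    koszul_bounded (t + \sum_i (a i).-1 * d i) (fun i => g i ^+ a i)
                   (fun i => (a i * d i)%N).
Proof.
move=> Gg K1 a; have [m] := ubnP (\sum_i (a i).-1)%N.
elim: m a => // m IH a am a0.
have mono s s' h e : (s <= s')%N -> koszul_bounded s h e -> koszul_bounded s' h e.
  by move=> ss' K n z s'n; apply: K; apply: leq_trans s'n.
have [/existsP[i0 a1]|] := boolP [exists i, (1 < a i)%N]; last first.
  rewrite negb_exists => /forallP a1.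
  have {}a1 i : a i = 1%N by apply/eqP; rewrite eqn_leq a0 andbT leqNgt.
  apply: mono (leq_addr _ _) _.
  rewrite (_ : (fun i => _ ^+ _) = g); last by apply/funext => i; rewrite a1.
  by rewrite (_ : (fun i => _) = d) //; apply/funext => i; rewrite a1 mul1n.
have updP c : (fun i => g i ^+ upd a i0 c i) = upd (fun i => g i ^+ a i) i0 (g i0 ^+ c).
  by apply/funext => i; rewrite /upd; case: eqP => [->|].
have updd c : (fun i => upd a i0 c i * d i)%N = upd (fun i => (a i * d i)%N) i0 (c * d i0)%N.
  by apply/funext => i; rewrite /upd; case: eqP => [->|].
have upda : upd a i0 (a i0) = a by apply/funext => i; rewrite /upd; case: eqP => [->|].
have sumE (w : I -> nat) c :
    (\sum_i (upd a i0 c i).-1 * w i = c.-1 * w i0 + \sum_(i | i != i0) (a i).-1 * w i)%N.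
  rewrite (bigD1 i0) //= upd_eq; congr (_ + _)%N.
  by apply: eq_bigr => i ii0; rewrite upd_neq.
have lower c : (0 < c)%N -> (c < a i0)%N ->
    koszul_bounded (t + \sum_i (upd a i0 c i).-1 * d i)
      (upd (fun i => g i ^+ a i) i0 (g i0 ^+ c)) (upd (fun i => (a i * d i)%N) i0 (c * d i0)%N).
  move=> c0 ca; rewrite -updP -updd; apply: IH => [|i]; last first.
    by rewrite /upd; case: ifP.
  rewrite -ltnS; apply: leq_trans am.
  have := sumE (fun=> 1%N) c; have := sumE (fun=> 1%N) (a i0); rewrite upda.
  under eq_bigr do rewrite muln1; move=> ->.
  under eq_bigr do rewrite muln1; move=> ->.
  by rewrite !ltnS !muln1 ltn_add2r ltn_predRL prednK.
rewrite -upda updP updd.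
have -> : (t + \sum_i (upd a i0 (a i0) i).-1 * d i =
  t + \sum_i (upd a i0 (a i0).-1 i).-1 * d i + d i0)%N.
  rewrite !sumE -addnA; congr (_ + _)%N; rewrite -addnA [X in (_ = _ + X)%N]addnC addnA.
  by congr (_ + _)%N; rewrite addnC -mulSn !prednK // -ltnS prednK.
have -> : g i0 ^+ a i0 = g i0 ^+ (a i0).-1 * g i0.
  by rewrite -exprSr prednK.
have -> : (a i0 * d i0 = (a i0).-1 * d i0 + d i0)%N.
  by rewrite addnC -mulSn prednK.
apply: koszul_bounded_mul => //.
- by move=> i ii0; apply: pieceX.
- exact: pieceX.
- by apply: lower; rewrite ?ltn_predL // -ltnS prednK.
- have := lower 1%N isT a1; rewrite expr1 mul1n; apply: mono.
  by rewrite !sumE leq_add2l leq_add2r.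
Qed.

End Koszul.

(** * Primary components *)

Section Components.
Variables (k : fieldType) (R : comAlgType k) (G : nat -> set R).
Hypothesis gradG : positive_grading G.
Implicit Types (I J P Q : set R).

Local Notation component := (component gradG).
Local Notation tail := (tail gradG).
Local Notation trunc := (trunc gradG).
Local Notation comp_closed := (comp_closed gradG).

Lemma ideal_power_mono (P Q : set R) c : P `<=` Q -> ideal_power P c `<=` ideal_power Q c.
Proof.
move=> PQ; apply: sub_smallest2r; first exact: ideal_gen_ideal.
by move=> _ [y Py ->]; exists y => // i; apply/PQ/Py.
Qed.

Lemma frobenius_power_sub J q Q :
  is_ideal Q -> (forall z, J z -> Q (z ^+ q)) -> frobenius_power J q `<=` Q.
Proof. by move=> idQ JQ; apply: smallest_sub => // _ [z Jz <-]; apply: JQ. Qed.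

Lemma tail_power c : ideal_power (tail 1) c `<=` tail c.
Proof.
apply: smallest_sub; first exact: tail_ideal.
move=> _ [y y1 ->]; elim: c y y1 => [|c IH] y y1; first by [].
rewrite big_ord_recl; apply: (tailM (m := 1) (n := c)) => //.
by apply: IH => i; apply: y1.
Qed.

Section IrrelevantComponent.
Variables (J : set R) (D : nat).
Hypotheses (idJ : is_ideal J) (J1 : J `<=` tail 1) (D0 : (0 < D)%N).

Definition irrelevant_component : set R :=
  [set u | exists2 v, J v & tail D (u - v)].

Lemma irrelevant_component_ideal : is_ideal irrelevant_component.
Proof.
have [J0 JD JM] := idJ; have [t0 tD tM] := tail_ideal gradG D.
split=> [|x y [v Jv xv] [w Jw yw]|a x [v Jv xv]].
- by exists 0; rewrite ?subr0.
- by exists (v + w); [exact: JD|rewrite opprD addrACA; exact: tD].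
- by exists (a * v); [exact: JM|rewrite -mulrBr; exact: tM].
Qed.

Lemma tail_irrelevant_component : tail D `<=` irrelevant_component.
Proof. by move=> x Dx; exists 0; rewrite ?subr0 //; case: idJ. Qed.

Lemma irrelevant_component_sub : irrelevant_component `<=` tail 1.
Proof.
move=> x [v /J1 Jv Dxv]; rewrite -[x](subrK v).
by case: (tail_ideal gradG 1) => _ tD _; apply: tD => //; apply: tail_le Dxv.
Qed.

Lemma radical_irrelevant_component : radical irrelevant_component `<=` tail 1.
Proof.
by move=> x [n /irrelevant_component_sub Qx]; apply: prime_expr Qx; apply: tail1_prime.
Qed.

(** An element outside the irrelevant ideal is a nonzero scalar plus an element
    nilpotent modulo the component, hence a unit modulo it. *)
Lemma irrelevant_component_primary : is_primary irrelevant_component.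
Proof.
have idQ := irrelevant_component_ideal; have [_ QD QM] := idQ.
split=> // [/irrelevant_component_sub|x y Qxy].
  by case/is_primeP: (tail1_prime gradG).
have [y1|ny1] := pselect (tail 1 y).
  right; exists D.-1; rewrite prednK //; apply: tail_irrelevant_component.
  by have := tailX (m := D) y1; rewrite mul1n.
left; have := comp_piece gradG 0 y; rewrite {1}(grading_0 gradG) => -[a _ ay].
have a0 : a != 0.
  by apply/eqP => a0; case: ny1 => -[] // _; rewrite -ay a0 scale0r.
have y'1 : tail 1 (a%:A - y).
  by case=> // _; rewrite compB ay (comp_homog _ _ (comp_piece gradG 0 y)) subrr.
have Qa : irrelevant_component (x * a%:A ^+ D).
  rewrite -[_ ^+ D](subrK ((a%:A - y) ^+ D)) mulrDr; apply: QD.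
    by rewrite subrXX subKr mulrA; apply: ideal_mulr.
  apply: QM; apply: tail_irrelevant_component.
  by have := tailX (m := D) y'1; rewrite mul1n.
have := QM (a^-1 ^+ D)%:A _ Qa.
have -> : a%:A ^+ D = (a ^+ D)%:A :> R by rewrite exprZn expr1n.
by rewrite -scalerAl mul1r -scalerAr mulr1 scalerA -exprMn mulVf // expr1n scale1r.
Qed.

End IrrelevantComponent.

Section PrimeComponent.
Variables (J P : set R).
Hypotheses (idJ : is_ideal J) (cJ : comp_closed J).
Hypotheses (pP : is_prime P) (cP : comp_closed P) (JP : J `<=` P).

(** The contraction of the localization of [J] at the forms outside [P]. Using
    forms only makes it evidently homogeneous. *)
Definition prime_component : set R :=
  [set u | exists a s, [/\ G a s, ~ P s & J (s * u)]].

Let PM u v : ~ P u -> ~ P v -> ~ P (u * v).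
Proof. by case/is_primeP: pP => _ _ PM nPu nPv /PM[]. Qed.

Lemma sub_prime_component : J `<=` prime_component.
Proof.
move=> u Ju; exists 0%N, 1; rewrite mul1r; split=> //; first exact: piece1.
by case/is_primeP: pP.
Qed.

Lemma prime_component_ideal : is_ideal prime_component.
Proof.
have [J0 JD JM] := idJ; split=> [|x y|u x [a [s [Gs nPs Jsx]]]].
- exact: sub_prime_component.
- move=> [a [s [Gs nPs Jsx]]] [b [t [Gt nPt Jty]]].
  exists (a + b)%N, (s * t); split; [exact: grading_mul|exact: PM|].
  rewrite mulrDr; apply: JD; last by rewrite -mulrA; apply: JM.
  by rewrite mulrAC; apply: ideal_mulr.
- by exists a, s; split=> //; rewrite mulrCA; apply: JM.
Qed.

Lemma prime_component_comp_closed : comp_closed prime_component.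
Proof.
move=> u i [a [s [Gs nPs Jsu]]]; have := cJ (a + i)%N Jsu.
by rewrite (compMhomog _ _ _ Gs) ltnNge leq_addr addKn; exists a, s.
Qed.

Lemma prime_component_cancel a s u :
  G a s -> ~ P s -> prime_component (u * s) -> prime_component u.
Proof.
move=> Gs nPs [b [t [Gt nPt Jtu]]]; exists (b + a)%N, (t * s).
by split; [exact: grading_mul|exact: PM|rewrite -mulrA [s * u]mulrC].
Qed.

Lemma radical_prime_component : radical prime_component `<=` P.
Proof.
move=> x [n [a [s [_ nPs /JP]]]].
by case/is_primeP: (pP) => _ _ PM' /PM'[] // /(prime_expr pP).
Qed.

(** Let [x * y] lie in the component and [y] outside [P]. Powers of the lower
    components of [y], which lie in [P], lie in the component; so [y] may be
    replaced by a power of its remaining part, whose lowest component [s] is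
    outside [P].  The components of [x * y] then give inductively
    [component i x * s], and [s] cancels. *)
Lemma prime_component_primary :
  P `<=` radical prime_component -> is_primary prime_component.
Proof.
move=> Prad; have idQ := prime_component_ideal; have [Q0 QD QM] := idQ.
have idP := prime_ideal pP.
split=> // [[a [s [_ nPs]]]|x y Qxy]; first by rewrite mulr1 => /JP.
have [/Prad ?|nPy] := pselect (P y); [by right|left].
have [a [nPya lowy]] := lowest_component_notin gradG idP nPy.
have [n Qlow] : radical prime_component (trunc a y - y).
  apply: Prad; rewrite /trunc addrAC subrr add0r; apply: ideal_oppr => //.
  by apply: ideal_sumr => // i _; apply: lowy.
pose m := n.+1; pose Y := trunc a y ^+ m.
have QxY : prime_component (x * Y).
  rewrite -[Y](subrK ((trunc a y - y) ^+ m)) mulrDr.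
  apply: QD; last exact: QM.
  by rewrite subrXX subKr mulrA; apply: ideal_mulr.
have tY : tail (a * m) Y by apply/tailX/trunc_tail.
have nPY : ~ P (component (a * m) Y).
  rewrite compX_tail; last exact: trunc_tail.
  by rewrite comp_trunc ltnn => /(prime_expr pP).
apply: (comp_closed_ext (gradG := gradG)) => // i.
elim/ltn_ind: i => i IH.
apply: (prime_component_cancel (comp_piece gradG (a * m) Y) nPY).
have := prime_component_comp_closed (i + a * m)%N QxY.
have lt_i : (i < (i + a * m).+1)%N by rewrite ltnS leq_addr.
rewrite compM (bigD1 (Ordinal lt_i)) //= addKn => Qs.
suff /(ideal_subr idQ Qs) : prime_component (\sum_(j < (i + a * m).+1 | j != Ordinal lt_i)
                 component j x * component (i + a * m - j) Y) by rewrite addrK.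
apply: ideal_sumr => // j; rewrite -val_eqE /= neq_ltn => /orP[ji|ij].
  by apply: ideal_mulr => //; apply: IH.
by rewrite tY ?mulr0 // ltn_subLR ?leq_ord // ltn_add2r.
Qed.

End PrimeComponent.

(** * The torsion modulo Frobenius powers *)

Section FrobeniusPowers.
Variables (s : nat) (f : 'I_s -> R) (e : 'I_s -> nat).
Hypothesis Gf : forall i, G (e i) (f i).

Definition power_span q : set R := [set u | exists r, u = \sum_i r i * f i ^+ q].

Definition fcons (T : Type) (x : T) (h : 'I_s -> T) (i : 'I_s.+1) : T :=
  if unlift ord0 i is Some j then h j else x.

Lemma fcons0 T x (h : 'I_s -> T) : fcons x h ord0 = x.
Proof. by rewrite /fcons unlift_none. Qed.

Lemma fconsS T x (h : 'I_s -> T) j : fcons x h (lift ord0 j) = h j.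
Proof. by rewrite /fcons liftK. Qed.

(** If [x * u] is a combination of the [f i ^+ q], then [u] is the entry at [x]
    of a syzygy of [x] and the [f i ^+ q]. Beyond the Koszul bound this
    syzygy is trivial, and its entry at [x] involves only the [f i ^+ q]. *)
Lemma saturation_bound x d N : noetherian R -> G d x ->
    (forall u, tail N u -> exists a b, u = a * x + \sum_i b i * f i) ->
  exists c, forall q n u, (0 < q)%N -> tail (c * q) u ->
    power_span q (x ^+ n * u) -> power_span q u.
Proof.
move=> noethR Gx xN; pose g := fcons x f; pose dg := fcons d e.
have Gg i : G (dg i) (g i).
  by rewrite /g /dg /fcons; case: unliftP => [j _|_].
have [|t Kt] := @koszul_bounded_exists _ _ _ gradG _ g dg N noethR Gg.
  move=> u /xN[a [b ->]]; exists (fcons a b).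
  rewrite big_ord_recl /g !fcons0; congr (_ + _).
  by apply: eq_bigr => i _; rewrite !fconsS.
exists (t + \sum_i e i)%N => q n u q0.
set D := ((t + _) * q)%N.
have step v : tail D v -> power_span q (x * v) -> power_span q v.
  move=> Dv [r xvr].
  have Dxv : tail (D + d) (x * v) by rewrite addnC; apply: tailM => //; apply: tail_piece Gx _.
  rewrite xvr in Dxv.
  have Gfq j : G (q * e j)%N (f j ^+ q) by apply: pieceX.
  have [r' r't r'E] := tail_combination Gfq Dxv.
  pose a := fcons 1%N (fun=> q).
  have a0 i : (0 < a i)%N by rewrite /a /fcons; case: unlift.
  have Ka := koszul_bounded_powers Gg Kt a0.
  pose z := fcons v (fun i => - r' i).
  have [|||C [C0 _] [_ CE]] := Ka (D + d)%N z.
  - apply: leq_trans (leq_addr _ _); rewrite big_ord_recl /a /dg !fcons0 add0n /D mulnDl.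
    apply: leq_add; first by rewrite leq_pmulr.
    rewrite big_distrl; apply: leq_sum => i _ /=; rewrite !fconsS mulnC.
    by rewrite leq_mul2l leq_pred orbT.
  - move=> i; rewrite /z /a /dg /fcons; case: unliftP => [j _|_]; last by rewrite mul1n addnK.
    by case: (tail_ideal gradG (D + d - q * e j)) => _ _ tM; rewrite -mulN1r; apply: tM.
  - rewrite big_ord_recl /z /a /g !fcons0 expr1 mulrC xvr r'E.
    by under [X in _ + X]eq_bigr do rewrite !fconsS mulNr; rewrite sumrN subrr.
  have := CE ord0; rewrite /z fcons0 big_ord_recl C0 mul0r add0r => ->.
  exists (fun j => C ord0 (lift ord0 j)); apply: eq_bigr => j _.
  by rewrite /a /g !fconsS.
move=> Du; elim: n => [|n IH]; first by rewrite mul1r.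
rewrite exprS -mulrA => /step xu; apply: IH; apply: xu.
by case: (tail_ideal gradG D) => _ _; apply.
Qed.

End FrobeniusPowers.

End Components.

(** * Linear growth *)

Section Main.
Variables (k : fieldType) (R : comAlgType k) (G : nat -> set R).
Hypothesis gradG : positive_grading G.
Implicit Types (I J P Q : set R).

Local Notation component := (component gradG).
Local Notation tail := (tail gradG).
Local Notation comp_closed := (comp_closed gradG).

(** In the product of primes lying in [I], replace each factor different from
    [P i] by a form of that factor outside [P i]: what remains is [s] times a
    product of at most [n] elements of [P i]. *)
Lemma power_locally_sub I n (P : 'I_n -> set R) i :
    short_chains I -> is_ideal I ->
    (forall i, [/\ is_prime (P i), comp_closed (P i) & I `<=` P i]) ->
    prod_sub P I -> P i <> tail 1 ->
  exists a s, [/\ G a s, ~ P i s &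
    forall c, (n <= c)%N -> ideal_power (P i) c `<=` colon I s].
Proof.
move=> shI idI primeP prodP Pi1; have [pPi cPi IPi] := primeP i.
have idPi := prime_ideal pPi.
have /choice[w wP] : forall j, exists w : nat * R,
    [/\ G w.1 w.2, ~ P i w.2 & P j <> P i -> P j w.2].
  move=> j; have [Pji|nPji] := pselect (P j = P i).
    exists (0%N, 1); split=> //; first exact: piece1.
    by case/is_primeP: pPi.
  have [pPj cPj IPj] := primeP j.
  have [v [Pv nPv]] : exists v, P j v /\ ~ P i v.
    apply: contrapT => H; apply: nPji.
    apply: (homogeneous_prime_maximal (gradG := gradG) shI) => // v Pv.
    by apply: contrapT => nPv; apply: H; exists v.
  have [b [nPb _]] := lowest_component_notin gradG idPi nPv.
  exists (b, component b v); split=> //; first exact: comp_piece.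
  by move=> _; apply: cPj.
exists (\sum_j (w j).1)%N, (\prod_j (w j).2); split.
- apply: (big_rec2 (fun e z => G e z)); first exact: piece1.
  by move=> j e z _; apply: (grading_mul gradG); case: (wP j).
- by move/(prime_prod pPi) => [j]; case: (wP j).
- move=> c /subnKC <-; apply: smallest_sub; first exact: colon_ideal.
  move=> _ [y Py ->]; rewrite /colon /= big_split_ord /= mulrAC.
  apply: ideal_mulr => //; rewrite -big_split /=.
  pose here j := `[< P j = P i >].
  rewrite (eq_bigr (fun j => (if here j then y (lshift (c - n) j) else (w j).2) *
                         (if here j then (w j).2 else y (lshift (c - n) j)))); last first.
    by move=> j _; case: ifP => _ //; rewrite mulrC.
  rewrite big_split; apply: ideal_mulr => //; apply: prodP => j.
  rewrite /here; case: asboolP => [->|nPj]; first exact: Py.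
  by case: (wP j) => _ _; apply.
Qed.

Lemma homogeneous_generators I : noetherian R -> homogeneous_ideal G I ->
  exists s (f : 'I_s -> R) (e : 'I_s -> nat), (forall i, G (e i) (f i)) /\
    I = ideal_gen [set f i | i in [set: 'I_s]].
Proof.
move=> noethR [S SG ->]; have [l [lS Sl]] := finite_generators noethR S.
pose f (i : 'I_(size l)) := tnth (in_tuple l) i.
have /choice[e eP] : forall i, exists e, G e (f i).
  by move=> i; have [e _ Ge] := SG _ (lS _ (mem_tnth i (in_tuple l))); exists e.
exists (size l), f, e; split=> //.
have lE : [set` l] = [set f i | i in [set: _]].
  apply/seteqP; split=> [x /= xl|_ [i _ <-]]; last exact: mem_tnth.
  by have /tnthP[i ->] : x \in in_tuple l by []; exists i.
rewrite -lE; apply/seteqP; split; apply: smallest_sub => //; try exact: ideal_gen_ideal.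
by move=> x xl; apply: sub_gen_smallest; apply: lS.
Qed.

Lemma frobenius_power_span s (f : 'I_s -> R) p e : p \in [pchar R] ->
  frobenius_power (ideal_gen [set f i | i in [set: 'I_s]]) (p ^ e) = power_span f (p ^ e).
Proof.
move=> pR; rewrite frobenius_power_gen // image_comp.
apply/seteqP; split=> u; first exact: (@ideal_gen_family _ _ (fun i => f i ^+ (p ^ e))).
case=> r ->; apply: ideal_sumr => [|i _]; first exact: ideal_gen_ideal.
have [_ _ gM] := ideal_gen_ideal [set f i ^+ (p ^ e) | i in [set: 'I_s]].
by apply: gM; apply: sub_gen_smallest; exists i.
Qed.

End Main.

Theorem theorem2p2 (p : nat) (k : fieldType) (hp : p \in [pchar k])
    (R : comAlgType k) (hR : finitely_generated_algebra R)
    (G : nat -> set R) (hG : positive_grading G)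
    (d : nat) (hd : krull_dim R d)
    (I : set R) (hI : homogeneous_ideal G I)
    (h : nat) (hh : ideal_height I h) (hdh : d = h.+1) :
  linear_growth_primary_decompositions p I.
Proof.
have noethR := finitely_generated_noetherian hR.
have pR : p \in [pchar R] by apply: (rmorph_pchar (GRing.in_alg R)).
have [s [f [e [Gf IE]]]] := homogeneous_generators noethR hI.
have idI : is_ideal I by rewrite IE; apply: ideal_gen_ideal.
have cI := homogeneous_comp_closed hG hI.
have shI := height_short_chains hd hh hdh.
have I1 : I `<=` tail hG 1.
  apply: comp_closed_sub_tail1 => // I1; case: hh => [[P [/is_primeP[_ P1 _] IP _]] _].
  exact/P1/IP.
have [n [P [primeP prodP]]] := homogeneous_prime_product noethR idI cI.
have [d' [x [N [d'0 Gx xP tN]]]] := homogeneous_parameter noethR shI primeP prodP idI cI.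
have [u /tN[y + [b ->]]|c0 c0P] := @saturation_bound _ _ _ hG _ _ _ Gf x d' N noethR Gx.
  rewrite IE => /ideal_gen_family[a ->].
  by exists b, a; rewrite addrC.
(* [c0] bounds the torsion and [n] the powers of the primes; the successor only
   makes [c] positive. *)
pose c := (c0 + n).+1; exists c; split=> // e'.
set q := (p ^ e')%N.
have q0 : (0 < q)%N by rewrite expn_gt0 prime_gt0 // (pcharf_prime hp).
set J := frobenius_power I q.
have idJ : is_ideal J by apply: ideal_gen_ideal.
have JE : J = power_span f q by rewrite /J IE; apply: frobenius_power_span.
have powJ z : I z -> J (z ^+ q) by move=> Iz; apply: sub_gen_smallest; exists z.
have cJ : comp_closed hG J.
  apply: homogeneous_comp_closed; exists [set z ^+ q | z in [set f i | i in [set: 'I_s]]].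
    by move=> _ [_ [i _ <-] <-]; exists (q * e i)%N => //; apply: pieceX.
  by rewrite -frobenius_power_gen // -IE.
have JI : J `<=` I.
  by apply: frobenius_power_sub => // z Iz; rewrite -(prednK q0) exprS; apply: ideal_mulr.
have cq0 : (0 < c * q)%N by rewrite muln_gt0.
pose Qm := irrelevant_component hG J (c * q).
pose QP j := prime_component G J (P j).
(* The extra index makes the component at the irrelevant ideal occur even when
   that ideal is none of the [P j]; it may be repeated. *)
pose Q (i : 'I_n.+1) :=
  if unlift ord0 i is Some j then if `[< P j = tail hG 1 >] then Qm else QP j else Qm.
have QE i : Q i = Qm \/ exists2 j, P j <> tail hG 1 & Q i = QP j.
  rewrite /Q; case: unliftP => [j _|_]; last by left.
  by case: asboolP => Pj; [left|right; exists j].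
have J1 : J `<=` tail hG 1 by apply: subset_trans I1.
have JP j : J `<=` P j by case: (primeP j) => _ _; apply: subset_trans.
have QPpow j : P j <> tail hG 1 -> forall z, ideal_power (P j) c z -> QP j (z ^+ q).
  move=> Pj z cz; have [a [t [Gt nPt tP]]] := power_locally_sub shI idI primeP prodP Pj.
  exists (q * a)%N, (t ^+ q); split; first exact: pieceX.
    by case: (primeP j) => pPj _ _ /(prime_expr pPj).
  rewrite -exprMn mulrC; apply: powJ; apply: (tP c) => //.
  by rewrite /c leqW // leq_addl.
have QPprimary j : P j <> tail hG 1 -> is_primary (QP j).
  move=> Pj; case: (primeP j) => pPj cPj _.
  apply: (prime_component_primary (gradG := hG)) => // y Py; exists (c * q).-1.
  rewrite prednK // exprM; apply: QPpow => //; apply: sub_gen_smallest.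
  by exists (fun=> y) => //; rewrite prodr_const card_ord.
exists n.+1, Q; split; last first.
  move=> i; case: (QE i) => [->|[j Pj ->]].
    apply: frobenius_power_sub => [|z cz]; first exact: irrelevant_component_ideal.
    apply: tail_irrelevant_component => //; apply: tailX.
    apply: tail_power; apply: ideal_power_mono cz.
    exact: radical_irrelevant_component.
  case: (primeP j) => pPj _ _.
  apply: frobenius_power_sub => [|z cz].
    exact: (prime_component_ideal hG).
  apply: QPpow => //; apply: ideal_power_mono cz.
  exact: radical_prime_component.
split=> [i|].
  case: (QE i) => [->|[j Pj ->]]; last exact: QPprimary.
  exact: irrelevant_component_primary.
apply/seteqP; split=> [u Ju i _|u Qu].
  case: (QE i) => [->|[j Pj ->]].
    by exists u; rewrite // subrr; case: (tail_ideal hG (c * q)).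
  by case: (primeP j) => pPj _ _; apply: (sub_prime_component hG).
(* Modulo [J], the element [u] is some [w] of high degree, whose homogeneous
   components can be treated separately. *)
have [v Jv tw] : Qm u by have := Qu ord0 Logic.I; rewrite /Q unlift_none.
set w := u - v in tw.
have Qw j : P j <> tail hG 1 -> QP j w.
  move=> Pj; case: (primeP j) => pPj _ _.
  apply: ideal_subr; first exact: (prime_component_ideal hG).
    by have := Qu (lift ord0 j) Logic.I; rewrite /Q liftK; case: asboolP.
  exact: (sub_prime_component hG).
suff Jw : J w by rewrite -[u](subrK v); case: (idJ) => _ JD _; apply: JD.
apply: (comp_closed_ext (gradG := hG)) => // i.
set wi := component hG i w.
have [|||j Pj|M MJ] := power_tail1_sub noethR shI primeP prodP (J := colon J wi).
- exact: colon_ideal.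
- exact: comp_closed_colon (comp_piece _ _ _).
- move=> Q' pQ' JQ' y Iy; apply: (prime_expr (n := q) pQ'); apply: JQ'.
  exact: (ideal_mulr wi idJ (powJ _ Iy)).
- case: (primeP j) => pPj _ _ colP.
  have [a [t [_ nPt Jt]]] := prime_component_comp_closed cJ i (Qw j Pj).
  by apply: nPt; apply: colP.
rewrite JE; apply: (c0P q M) => //.
  apply: comp_tail; apply: tail_le tw; rewrite leq_mul2r; apply/orP; right.
  by rewrite /c leqW // leq_addr.
rewrite -JE; have := MJ (fun=> x); rewrite prodr_const card_ord; apply=> _.
exact: tail_piece Gx d'0.
Qed.
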